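(* Let $(X,d)$ be a metric space and $\phi:X\to(-\infty,+\infty]$ a proper lower semicontinuous functional. Suppose that $\phi$ has complete sublevels, $\mathrm{Dom}(\phi)$ is an approximate length subset of $X$, and for some $\lambda\le0$ the $\mathrm{EVI}_\lambda$-gradient flow $\mathsf S_t$ of $\phi$ exists in $\overline{\mathrm{Dom}(\phi)}$. Then for every $u_0\in\mathrm{Dom}(|\partial\phi|)$ the sets $\mathsf{GMM}(X,d,\phi;u_0)$ and $\mathsf{MM}(X,d,\phi;u_0)$ coincide and contain as a unique element the curve $(\mathsf S_t(u_0))_{t\ge0}$.
   Context: $\mathrm{Dom}(\phi):=\{x\in X:\phi(x)<+\infty\}$. Metric slope: $|\partial\phi|(x):=+\infty$ if $x\notin\mathrm{Dom}(\phi)$; $:=0$ if $x\in\mathrm{Dom}(\phi)$ is isolated; $:=\limsup_{y\to x}\frac{(\phi(x)-\phi(y))^+}{d(x,y)}$ otherwise. $\mathrm{Dom}(|\partial\phi|):=\{x:|\partial\phi|(x)<+\infty\}$. ''Complete sublevels'': $\{\phi\le c\}$ is complete for every $c\in\mathbb R$. $D\subset X$ is an approximate length subset if for every $x_0,x_1\in D$ and $\varepsilon\in(0,1)$ there is $x\in D$ with $d^2(x_0,x)+d^2(x,x_1)\le\frac12d^2(x_0,x_1)(1+\varepsilon^2/4)$. For $\tau>0$, $\eta\ge0$, a $(\tau,\eta)$-discrete Minimizing Movement starting from $U^0_{\tau,\eta}\in\mathrm{Dom}(\phi)$ is a sequence $(U^n_{\tau,\eta})_{n\in\mathbb N}$ in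 $\mathrm{Dom}(\phi)$ such that for every $n\ge1$ $$\tfrac1{2\tau}d^2(U^n_{\tau,\eta},U^{n-1}_{\tau,\eta})+\phi(U^n_{\tau,\eta})\le\tfrac1{2\tau}d^2(V,U^{n-1}_{\tau,\eta})+\phi(V)+\tfrac\eta2\,d(U^n_{\tau,\eta},U^{n-1}_{\tau,\eta})\,d(V,U^n_{\tau,\eta})\quad\text{for every }V\in\mathrm{Dom}(\phi),$$ $$\tfrac1{2\tau}d^2(U^n_{\tau,\eta},U^{n-1}_{\tau,\eta})+\phi(U^n_{\tau,\eta})\le\phi(U^{n-1}_{\tau,\eta}).$$ $\mathsf{MM}_{\tau,\eta}(U^0_{\tau,\eta})$ is the collection of all of them. The piecewise constant interpolant is $\overline U_{\tau,\eta}(t):=U^n_{\tau,\eta}$ if $t\in((n-1)\tau,n\tau]$, $\overline U_{\tau,\eta}(0):=U^0_{\tau,\eta}$. A curve $u:[0,+\infty)\to X$ belongs to $\mathsf{MM}(X,d,\phi;u_0)$ if $u(0)=u_0$ and there exist $\eta\ge0$ and interpolants $\overline U_{\tau,\eta}$ associated with sequences in $\mathsf{MM}_{\tau,\eta}(u_0)$ for all sufficiently small $\tau>0$ such that $\lim_{\tau\downarrow0}\overline U_{\tau,\eta}(t)=u(t)$ for every $t\ge0$. It belongs to $\mathsf{GMM}(X,d,\phi;u_0)$ if $u(0)=u_0$ and there exist $\eta\ge0$, a vanishing sequence $\tau(k)\downarrow0$ and interpolants $\overline U_{\tau(k),\eta}$ associated with sequences in $\mathsf{MM}_{\tau(k),\eta}(u_0)$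 such that $\lim_{k\to\infty}\overline U_{\tau(k),\eta}(t)=u(t)$ for every $t\ge0$. With $\frac{\mathrm d}{\mathrm dt}^{+}\zeta(t):=\limsup_{h\downarrow0}\frac{\zeta(t+h)-\zeta(t)}h$, a solution of $\mathrm{EVI}_\lambda(X,d,\phi)$ is a continuous curve $u:(0,+\infty)\to\mathrm{Dom}(\phi)$ with $\frac12\frac{\mathrm d}{\mathrm dt}^{+}d^2(u_t,v)+\frac\lambda2d^2(u_t,v)\le\phi(v)-\phi(u_t)$ for every $t>0$, $v\in\mathrm{Dom}(\phi)$. An $\mathrm{EVI}_\lambda$-gradient flow of $\phi$ in $D\subset\overline{\mathrm{Dom}(\phi)}$ is a family of continuous maps $\mathsf S_t:D\to D$, $t\ge0$, such that for every $u_0\in D$: $\mathsf S_{t+h}(u_0)=\mathsf S_h(\mathsf S_t(u_0))$ for all $t,h\ge0$, $\lim_{t\downarrow0}\mathsf S_t(u_0)=\mathsf S_0(u_0)=u_0$, and $t\mapsto\mathsf S_t(u_0)$ is a solution of $\mathrm{EVI}_\lambda(X,d,\phi)$. *)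

(* Defs.v *)
From mathcomp Require Import all_boot all_order all_algebra.
From mathcomp Require Import all_classical all_reals all_analysis.

Set Implicit Arguments.
Unset Strict Implicit.
Unset Printing Implicit Defensive.

Import Order.TTheory GRing.Theory Num.Theory.
Import numFieldNormedType.Exports.

Local Open Scope classical_set_scope.
Local Open Scope ring_scope.

Definition dom {R : realType} {T : Type} (f : T -> \bar R) : set T :=
  [set x | f x < +oo]%E.

Definition complete_set {T : uniformType} (A : set T) : Prop :=
  forall u : nat -> T, (forall n, A (u n)) -> cauchy (u @ \oo) ->
    exists2 x, A x & u @ \oo --> x.

Definition complete_sublevels {R : realType} {X : metricType R}
    (phi : X -> \bar R) : Prop :=
  forall c : R, complete_set [set x | phi x <= c%:E]%E.

(* A point of dom phi that is isolated in dom phi but not in X also gets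
   slope 0, since the quotient vanishes where phi y = +oo. *)
Definition metric_slope {R : realType} {X : metricType R}
    (phi : X -> \bar R) (x : X) : \bar R :=
  (if phi x < +oo then
     if `[< isolated [set: X] x >] then 0
     else limf_esup
       (fun y => maxe (phi x - phi y) 0 * ((mdist x y)^-1)%:E) x^'
   else +oo)%E.

Definition approximate_length_subset {R : realType} {X : metricType R}
    (D : set X) : Prop :=
  forall x0 x1 : X, D x0 -> D x1 ->
  forall e : R, 0 < e < 1 ->
  exists2 x, D x & mdist x0 x ^+ 2 + mdist x x1 ^+ 2 <=
    2^-1 * mdist x0 x1 ^+ 2 * (1 + e ^+ 2 / 4).

Definition discrete_MM {R : realType} {X : metricType R}
    (phi : X -> \bar R) (tau eta : R) (U0 : X) : set (nat -> X) :=
  [set U | [/\ U 0%N = U0,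
    forall n, dom phi (U n),
    forall n V, dom phi V ->
      (((2 * tau)^-1 * mdist (U n.+1) (U n) ^+ 2)%:E + phi (U n.+1) <=
       ((2 * tau)^-1 * mdist V (U n) ^+ 2)%:E + phi V +
       (eta / 2 * mdist (U n.+1) (U n) * mdist V (U n.+1))%:E)%E &
    forall n,
      (((2 * tau)^-1 * mdist (U n.+1) (U n) ^+ 2)%:E + phi (U n.+1) <=
       phi (U n))%E]].

(* Only meaningful for 0 < tau and 0 <= t. *)
Definition interpolant {R : realType} {X : Type} (tau : R) (U : nat -> X)
  (t : R) : X := U `|Num.ceil (t / tau)|%N.

Lemma interpolant0 {R : realType} {X : Type} (tau : R) (U : nat -> X) :
  interpolant tau U 0 = U 0%N.
Proof. by rewrite /interpolant mul0r ceil0. Qed.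

Lemma interpolantS {R : realType} {X : Type} (tau : R) (U : nat -> X)
    (n : nat) (t : R) :
  0 < tau -> n%:R * tau < t <= n.+1%:R * tau -> interpolant tau U t = U n.+1.
Proof.
move=> tau0 /andP[nt tn]; rewrite /interpolant.
suff -> : Num.ceil (t / tau) = n.+1%:Z by [].
apply: ceil_def; rewrite ler_pdivrMr// ltr_pdivlMr//.
by rewrite (_ : n.+1%:Z - 1 = n%:Z) ?nt ?tn// -addn1 PoszD addrK.
Qed.

(* Curves defined on [0, +oo[ are functions on {nonneg R}, so that equality of
   sets of curves does not involve values at negative times. *)
Definition MM {R : realType} {X : metricType R}
    (phi : X -> \bar R) (u0 : X) : set ({nonneg R} -> X) :=
  [set u | u 0%:nng = u0 /\
    exists eta : R, 0 <= eta /\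
    exists U : R -> nat -> X,
      (\forall tau \near 0^'+, discrete_MM phi tau eta u0 (U tau)) /\
      forall t : {nonneg R},
        interpolant tau (U tau) t%:num @[tau --> 0^'+] --> u t].

Definition GMM {R : realType} {X : metricType R}
    (phi : X -> \bar R) (u0 : X) : set ({nonneg R} -> X) :=
  [set u | u 0%:nng = u0 /\
    exists eta : R, 0 <= eta /\
    exists (tau : nat -> R) (U : nat -> nat -> X),
      [/\ forall k, 0 < tau k,
          tau k @[k --> \oo] --> 0,
          forall k, discrete_MM phi (tau k) eta u0 (U k) &
          forall t : {nonneg R},
            interpolant (tau k) (U k) t%:num @[k --> \oo] --> u t]].

Definition upper_right_derivative {R : realType} (zeta : R -> R) (t : R) :
  \bar R := limf_esup (fun h : R => ((zeta (t + h) - zeta t) / h)%:E) 0^'+.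

(* The values of u outside ]0, +oo[ are irrelevant. *)
Definition EVI_solution {R : realType} {X : metricType R} (lambda : R)
    (phi : X -> \bar R) (u : R -> X) : Prop :=
  [/\ forall t : R, 0 < t -> dom phi (u t),
      {in `]0, +oo[, continuous u} &
      forall (t : R) (v : X), 0 < t -> dom phi v ->
        ((2^-1)%:E * upper_right_derivative (fun s => mdist (u s) v ^+ 2)%R t +
         (lambda / 2 * mdist (u t) v ^+ 2)%:E <= phi v - phi (u t))%E].

(* S t stands for a map from D to D, for 0 <= t: its values outside D, and
   S t for t < 0, are irrelevant. *)
Definition EVI_flow {R : realType} {X : metricType R} (lambda : R)
    (phi : X -> \bar R) (D : set X) (S : R -> X -> X) : Prop :=
  [/\ D `<=` closure (dom phi),
      forall t : R, 0 <= t -> forall x, D x -> D (S t x),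
      forall t : R, 0 <= t -> {within D, continuous (S t)} &
      forall u0, D u0 ->
        [/\ forall t h : R, 0 <= t -> 0 <= h -> S (t + h) u0 = S h (S t u0),
            S t u0 @[t --> 0^'+] --> S 0 u0,
            S 0 u0 = u0 &
            EVI_solution lambda phi (S ^~ u0)]].

(* Main.v *)
(* Everything is obtained from Dini-derivative inequalities for squared
   distances. Write d for the distance, L for -lambda, and say that x has global
   slope at most s if phi x - phi v <= s d(x,v) + L/2 d^2(x,v) for all v in the
   domain.

   (1) On [0,b] the energy along a flow line attains its minimum, say at time r;
   EVI tested with the point S_r x forces the curve to stay there, so the energy
   is nonincreasing. With lower semicontinuity this gives the contraction
   d(S_t x, S_t y) <= e^(Lt) d(x,y).

   (2) A bound on the local slope at x bounds the speed of S_t x near t = 0,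
   hence, by contraction, at every time, and EVI converts the speed bound into a
   bound on the global slope.

   (3) The flow turns the approximate geodesics of the domain into points along
   which phi is approximately (-L)-convex. Testing a discrete step x -> y of
   length a with such points close to y gives
   a^2/tau <= phi x - phi y + O(a^2), while the local slope of y is at most
   s' = a (1/tau + eta/2).

   (4) EVI from x tested with y and (3) give
   d^2(S_tau x, y) <= tau^2 (s^2 - s'^2 + O(tau) s^2), where s is the slope at x.
   The right-hand sides telescope, so by contraction the errors up to a fixed
   time sum up to O(tau^(1/2)).

   (5) For eta = 1 and small tau the discrete steps exist by Ekeland's
   variational principle. *)

Require Import Defs.
From mathcomp Require Import all_boot all_order all_algebra.
From mathcomp Require Import all_classical all_reals all_analysis.
From mathcomp Require Import ring lra.
Import Order.TTheory GRing.Theory Num.Theory.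
Import numFieldNormedType.Exports.
Local Open Scope classical_set_scope.
Local Open Scope ring_scope.

Set Implicit Arguments.
Unset Strict Implicit.

(** * Dini derivatives *)

Section Dini.
Variable R : realType.
Implicit Types (f : R -> R) (a b c t h e : R).

(** Bounds the upper right Dini derivative of [f] at [t] by [c]. No limsup is formed, so the rules
    for sums and multiples reduce to splitting [e]. *)
Definition dini_upper f t c :=
  forall e, 0 < e -> \forall h \near 0^'+, f (t + h) <= f t + h * (c + e).

Lemma near_right0P (P : R -> Prop) :
  (\forall h \near 0^'+, P h) <->
  exists2 d : R, 0 < d & forall h, 0 < h -> h < d -> P h.
Proof.
split=> [|[d d0 Pd]].
  rewrite /at_right /within /= => /nbhs_ballP[d /= d0 Pd]; exists d => // h h0 hd.
  by apply: Pd => //; rewrite /ball /= sub0r normrN gtr0_norm.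
near=> h; apply: Pd; near: h; first exact: nbhs_right_gt.
exact: nbhs_right_lt.
Unshelve. all: by end_near. Qed.

(** By continuity the set of [t] in [[a, b]] with [f t <= f a + e * (t - a)] contains its supremum
    [s]; if [s < b], the Dini bound at [s] yields a larger element. *)
Lemma dini_nonincreasing f a b : continuous f -> a < b ->
  (forall t, a <= t -> t < b -> dini_upper f t 0) -> f b <= f a.
Proof.
move=> cf ab df; apply/ler_addgt0Pr => e0 e00.
pose e := e0 / (b - a); have e_gt0 : 0 < e by rewrite divr_gt0 ?subr_gt0.
have -> : e0 = e * (b - a) by rewrite /e divfK// gt_eqF// subr_gt0.
pose A := [set t | a <= t <= b /\ f t <= f a + e * (t - a)].
have Aa : A a by split; [rewrite lexx ltW|rewrite subrr mulr0 addr0].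
have hA : has_sup A.
  by split; [exists a|exists b => t [/andP[]]].
pose s := sup A.
have as_ : a <= s by apply: ub_le_sup => //; case: hA.
have sb : s <= b by apply: ge_sup; [exists a|move=> t [/andP[]]].
have As : f s <= f a + e * (s - a).
  rewrite leNgt; apply/negP => fs.
  pose g t := f t - e * (t - a).
  have cg : continuous g.
    move=> t; apply: cvgB; first exact: cf.
    apply: cvgM; first exact: cvg_cst.
    by apply: cvgB; [exact: cvg_id|exact: cvg_cst].
  have : \forall t \near s, f a < g t.
    by apply: (cvgr_gt (g s) (cg s)); rewrite /g ltrBrDr.
  move=> /nbhs_ballP[d /= d0 Hd].
  have [t At st] := sup_adherent d0 hA.
  have ts : t <= s by apply: ub_le_sup => //; case: hA.
  have /Hd : ball s d t by rewrite /ball/= ger0_norm ?subr_ge0// ltrBlDr -ltrBlDl.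
  by case: At => _; rewrite /g; lra.
move: sb; rewrite le_eqVlt => /predU1P[<-//|sb].
have /(_ e e_gt0)/near_right0P[d d0 Hd] := df s as_ sb.
pose h := Num.min (d / 2) (b - s).
have h0 : 0 < h by rewrite lt_min divr_gt0//= subr_gt0.
have hd : h < d by rewrite gt_min; apply/orP; left; lra.
have hb : h <= b - s by rewrite ge_min lexx orbT.
have Ash : A (s + h).
  split; first by apply/andP; split; lra.
  by have := Hd h h0 hd; lra.
have : s + h <= s by apply: ub_le_sup => //; case: hA.
lra.
Qed.

Lemma dini_upperD f g t c d : dini_upper f t c -> dini_upper g t d ->
  dini_upper (f \+ g) t (c + d).
Proof.
move=> fc gd e e0; have e2 : 0 < e / 2 by rewrite divr_gt0.
near=> h.
have : f (t + h) <= f t + h * (c + e / 2) by near: h; exact: fc.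
have : g (t + h) <= g t + h * (d + e / 2) by near: h; exact: gd.
rewrite /=; lra.
Unshelve. all: by end_near. Qed.

Lemma dini_upperZ f t c k : 0 <= k -> dini_upper f t c ->
  dini_upper (fun r => k * f r) t (k * c).
Proof.
move=> k0 fc e e0; have k1 : 0 < k + 1 by lra.
near=> h.
have h0 : 0 < h by [].
(* The denominator is [k + 1] because [k] may be 0. *)
have : f (t + h) <= f t + h * (c + e / (k + 1)).
  by near: h; apply: fc; rewrite divr_gt0.
move/(ler_wpM2l k0)/le_trans; apply; rewrite mulrDr lerD2l mulrCA ler_pM2l// mulrDr.
rewrite lerD2l mulrCA ger_pMr// ler_pdivrMr//; lra.
Unshelve. all: by end_near. Qed.

Lemma dini_upper_le f t c c' : c <= c' -> dini_upper f t c -> dini_upper f t c'.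
Proof.
move=> cc fc e e0; near=> h.
have h0 : 0 < h by [].
have : f (t + h) <= f t + h * (c + e) by near: h; exact: fc.
by move/le_trans; apply; rewrite lerD2l ler_pM2l// lerD2r.
Unshelve. all: by end_near. Qed.

Lemma dini_upper_quadratic t c k :
  dini_upper (fun r => c * r + k * r ^+ 2) t (c + 2 * k * t).
Proof.
move=> e e0; have k1 : 0 < `|k| + 1 by rewrite ltr_wpDl.
near=> h.
have h0 : 0 < h by [].
have : h < e / (`|k| + 1) by near: h; apply: nbhs_right_lt; rewrite divr_gt0.
rewrite ltr_pdivlMr// => he.
have : k * h <= e by have := ler_norm k; nra.
nra.
Unshelve. all: by end_near. Qed.

Lemma continuous_quadratic c k : continuous (fun r : R => c * r + k * r ^+ 2).
Proof.
move=> r; apply: cvgD.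
  by apply: cvgM; [exact: cvg_cst|exact: cvg_id].
by apply: cvgM; [exact: cvg_cst|apply: (cvgM cvg_id cvg_id)].
Qed.

(** Subtracting a primitive of [c + k * t] reduces this to monotonicity. The bound is assumed only
    in the open interval, since EVI holds only at positive times; the left endpoint is reached by
    continuity. *)
Lemma dini_affine_le f a b c k : continuous f -> a <= b ->
  (forall t, a < t -> t < b -> dini_upper f t (c + k * t)) ->
  f b <= f a + c * (b - a) + k / 2 * (b ^+ 2 - a ^+ 2).
Proof.
move=> cf; rewrite le_eqVlt => /predU1P[->|ab df].
  by rewrite !subrr !mulr0 !addr0.
pose q r := (- c) * r + (- k / 2) * r ^+ 2.
have cg : continuous (f \+ q).
  by move=> r; apply: cvgD; [exact: cf|exact: continuous_quadratic].
suff : f b + q b <= f a + q a by rewrite /q; lra.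
have key a' : a < a' -> a' < b -> (f \+ q) b <= (f \+ q) a'.
  move=> aa' a'b; apply: dini_nonincreasing => // t a't tb.
  have := dini_upperD (df t (lt_le_trans aa' a't) tb)
    (dini_upper_quadratic t (- c) (- k / 2)).
  by apply: dini_upper_le; lra.
have ca : (f \+ q) a' @[a' --> a^'+] --> (f \+ q) a.
  exact/cvg_at_right_filter/cg.
apply: (ler_cvg_to (cvg_cst ((f \+ q) b)) ca); near=> a'.
by apply: key; near: a'; [exact: nbhs_right_gt|exact: nbhs_right_lt].
Unshelve. all: by end_near. Qed.

(** The integrating factor e^(-Kr) cancels the term [K * f t], and being at most 1 it leaves the
    Dini bound [s]. *)
Lemma gronwall f K s b : continuous f -> (forall t, 0 <= f t) -> 0 <= K ->
  0 <= s -> 0 <= b ->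
  (forall t, 0 < t -> t < b -> dini_upper f t (s + K * f t)) ->
  f b <= expR (K * b) * (f 0 + s * b).
Proof.
move=> cf f0 K0 s0 b0 df.
pose g r := expR (- K * r) * f r.
have cg : continuous g.
  move=> r; apply: cvgM; last exact: cf.
  apply: (@continuous_comp _ _ _ ( *%R (- K)) (@expR R)); first exact: mulrl_continuous.
  exact: continuous_expR.
have dg t : 0 < t -> t < b -> dini_upper g t (s + 0 * t).
  move=> t0 tb e e0; near=> h.
  have h0 : 0 < h by [].
  have fh : f (t + h) <= f t + h * (s + K * f t + e).
    by near: h; exact: df.
  have E1 : expR (- K * t) = expR (- K * (t + h)) * expR (K * h).
    by rewrite -expRD; congr expR; ring.
  have e1 : expR (- K * (t + h)) <= 1.
    by rewrite expR_le1// mulNr oppr_le0 mulr_ge0// addr_ge0// ltW.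
  rewrite /g mul0r addr0 E1 -mulrA -lerBlDl -mulrBr.
  have D : f (t + h) - expR (K * h) * f t <= h * (s + e).
    have := expR_ge1Dx (K * h).
    by move/(ler_wpM2r (f0 t)); lra.
  apply: (le_trans (ler_wpM2l (expR_ge0 _) D)).
  by rewrite ler_piMl// mulr_ge0//; lra.
have := dini_affine_le cg b0 dg.
rewrite /g mulr0 expR0 mul1r subr0 mul0r mul0r addr0 => H.
rewrite -(@ler_pM2l _ (expR (- K * b))) ?expR_gt0// mulrA -expRD.
by rewrite mulNr addNr expR0 mul1r -mulNr.
Unshelve. all: by end_near. Qed.
(* Regularising by k makes the chain rule for the square root valid where f
   vanishes. *)
Lemma dini_sqrt f K s k t : 0 <= K -> 0 <= s -> 0 < k ->
  (forall r, 0 <= f r) ->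
  dini_upper (fun r => f r ^+ 2) t (2 * f t * (s + K * f t)) ->
  dini_upper (fun r => Num.sqrt (f r ^+ 2 + k ^+ 2)) t
    (s + K * Num.sqrt (f t ^+ 2 + k ^+ 2)).
Proof.
move=> K0 s0 k0 f0 df e e0; have ek : 0 < 2 * e * k by rewrite !mulr_gt0.
near=> h; have h0 : 0 < h by [].
(* Since the regularised root [E] is at least [k], a slack of [2 * e * k] for the square becomes a
   slack of at most [e] for the root. *)
have H : f (t + h) ^+ 2 <= f t ^+ 2 + h * (2 * f t * (s + K * f t) + 2 * e * k).
  by near: h; exact: df.
set E := Num.sqrt (f t ^+ 2 + k ^+ 2).
have E0 : 0 <= E by exact: sqrtr_ge0.
have E2 : E ^+ 2 = f t ^+ 2 + k ^+ 2 by rewrite sqr_sqrtr// addr_ge0// sqr_ge0.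
have ft0 := f0 t.
have fE : f t <= E by rewrite -(@ler_pXn2r _ 2)// E2 lerDl sqr_ge0.
have kE : k <= E by rewrite -(@ler_pXn2r _ 2)// ?nnegrE ?(ltW k0)// E2 lerDr sqr_ge0.
have c0 : 0 <= s + K * E + e by rewrite addr_ge0 ?(ltW e0)// addr_ge0 ?mulr_ge0.
have Eh0 : 0 <= E + h * (s + K * E + e) by rewrite addr_ge0// mulr_ge0// ltW.
rewrite -[leRHS]ger0_norm// -sqrtr_sqr; apply: ler_wsqrtr.
have KE : 0 <= K * (E - f t) * E by rewrite !mulr_ge0// subr_ge0.
have KE' : 0 <= K * (E - f t) * f t by rewrite !mulr_ge0// subr_ge0.
have sE : 0 <= s * (E - f t) by rewrite mulr_ge0// subr_ge0.
have kE' : 0 <= e * (E - k) by rewrite mulr_ge0// ?subr_ge0// ltW.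
have : 2 * f t * (s + K * f t) + 2 * e * k <= 2 * E * (s + K * E + e) by lra.
move=> /(ler_wpM2l (ltW h0)).
have := sqr_ge0 (h * (s + K * E + e)); lra.
Unshelve. all: by end_near. Qed.

End Dini.

(** * Energy and contraction along the flow *)

(** The sublevels of [q] in [A] are nested, hence generate a proper filter; by lower semicontinuity
    a cluster point of it is a minimiser. *)
Lemma lsc_compact_min (R : realType) (T : topologicalType) (A : set T)
    (q : T -> R) : A !=set0 -> compact A ->
  (forall x e, A x -> 0 < e -> \forall y \near x, A y -> q x - e < q y) ->
  exists2 s, A s & forall t, A t -> q s <= q t.
Proof.
move=> [a0 Aa0] cA lq.
pose B c := [set t | A t /\ q t <= q c].
pose F := filter_from A B.
have FF : ProperFilter F.
  apply: filter_from_proper; last by move=> c Ac; exists c; split.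
  apply: filter_from_filter; first by exists a0.
  move=> i j Ai Aj; have [ij|/ltW ji] := leP (q i) (q j).
    by exists i => // t [At ti]; split; split => //; exact: le_trans ij.
  by exists j => // t [At tj]; split; split => //; exact: le_trans ji.
have [|s [As cs]] := cA F FF; first by exists a0 => // t [].
exists s => // t At; rewrite leNgt; apply/negP => ts.
have /cs : F (B t) by exists t.
have /(lq _ _ As) Us : 0 < q s - q t by rewrite subr_gt0.
by move=> /(_ _ Us)[y [[Ay yt] /(_ Ay)]]; lra.
Qed.

Section Metric.
Variables (R : realType) (X : metricType R).
Implicit Types x y z : X.

Lemma continuous_mdist (T : topologicalType) (f g : T -> X) :
  continuous f -> continuous g -> continuous (fun t => mdist (f t) (g t)).
Proof.
move=> cf cg t; apply/cvgrPdist_le => e e0; near=> r.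
have : mdist (f t) (f r) <= e / 2.
  by near: r; apply: metricType_numDomainType.cvgr_dist_le; [exact: cf|lra].
have : mdist (g t) (g r) <= e / 2.
  by near: r; apply: metricType_numDomainType.cvgr_dist_le; [exact: cg|lra].
have := metric_triangle (f t) (f r) (g t); have := metric_triangle (f r) (g r) (g t).
have := metric_triangle (f r) (f t) (g r); have := metric_triangle (f t) (g t) (g r).
by rewrite (metric_sym (f r) (f t)) (metric_sym (g r) (g t)) ler_norml; lra.
Unshelve. all: by end_near. Qed.

Lemma continuous_sqr_mdist (T : topologicalType) (f g : T -> X) :
  continuous f -> continuous g -> continuous (fun t => mdist (f t) (g t) ^+ 2).
Proof.
move=> cf cg t; apply: (@cvgM _ _ _ _ (fun t => mdist (f t) (g t)));
  exact: continuous_mdist.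
Qed.

End Metric.

(** Real-valued form of the flow on the domain itself: [p] is the finite energy, [L] is minus
    lambda, and EVI is multiplied by 2. Continuity of [w x] is required on the whole line, so that
    the Dini lemmas apply directly. *)
Record evi_semiflow (R : realType) (X : metricType R) (D : set X) (p : X -> R)
    (L : R) (w : X -> R -> X) : Prop := EviSemiflow {
  esf_ge0 : 0 <= L;
  esf_lsc : forall x e, D x -> 0 < e ->
    \forall y \near x, D y -> p x - e < p y;
  esf_dom : forall x t, D x -> 0 <= t -> D (w x t);
  esf_continuous : forall x, D x -> continuous (w x);
  esf0 : forall x, D x -> w x 0 = x;
  esfD : forall x s t, D x -> 0 <= s -> 0 <= t -> w x (s + t) = w (w x s) t;
  esf_evi : forall x v t, D x -> D v -> 0 < t ->
    dini_upper (fun r => mdist (w x r) v ^+ 2) t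
      (L * mdist (w x t) v ^+ 2 + 2 * (p v - p (w x t))) }.

Section EVI.
Variables (R : realType) (X : metricType R) (D : set X) (p : X -> R) (L : R).
Variable w : X -> R -> X.
Hypothesis F : evi_semiflow D p L w.
Implicit Types x y v : X.

Let L0 : 0 <= L := esf_ge0 F.

Lemma continuous_sqr_mdist_flow x v : D x ->
  continuous (fun r => mdist (w x r) v ^+ 2).
Proof.
move=> Dx; apply: continuous_sqr_mdist; first exact: esf_continuous F _ Dx.
by move=> t; exact: cvg_cst.
Qed.

Lemma energy_le_start x (b : R) : D x -> 0 <= b -> p (w x b) <= p x.
Proof.
move=> Dx b0; pose A : set R := [set` `[0, b]].
have [|||s] := @lsc_compact_min R R A (p \o w x).
- by exists 0; rewrite /A /= in_itv /= lexx.
- exact: segment_compact.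
- move=> t e; rewrite /A /= in_itv /= => /andP[t0 tb] e0.
  have := esf_lsc F (esf_dom F Dx t0) e0.
  move=> /(esf_continuous F Dx) H.
  near=> y; rewrite in_itv /= => /andP[y0 _].
  have : D (w x y) -> p (w x t) - e < p (w x y) by near: y; exact: H.
  by apply; exact: (esf_dom F).
rewrite /A /= in_itv /= => /andP[s0 sb] smin.
have Dz := esf_dom F Dx s0.
have cb : 0 <= b - s by rewrite subr_ge0.
(* If the flow is back at the minimiser at time [b], the energy there is the minimum, hence at most
   the initial one. *)
suff zE : w (w x s) (b - s) = w x s.
  have -> : b = s + (b - s) by rewrite addrC subrK.
  rewrite (esfD F)// zE.
  by have := smin 0; rewrite /= in_itv /= lexx b0 (esf0 F)//; exact.
apply: mdist_positivity; apply/eqP; rewrite -sqrf_eq0 eq_le sqr_ge0 andbT.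
have := @gronwall R (fun r => mdist (w (w x s) r) (w x s) ^+ 2) L 0 (b - s).
rewrite (esf0 F)// mdistxx expr0n /= mul0r addr0 mulr0; apply => //.
- exact: continuous_sqr_mdist_flow.
- by move=> t; exact: sqr_ge0.
move=> t t0 tb; apply: dini_upper_le (esf_evi F Dz Dz t0).
rewrite add0r gerDl pmulr_rle0// subr_le0 -(esfD F)//; last exact: ltW.
by apply: smin; rewrite /= in_itv /=; lra.
Unshelve. all: by end_near. Qed.

Lemma energy_nonincreasing x (a b : R) : D x -> 0 <= a -> a <= b ->
  p (w x b) <= p (w x a).
Proof.
move=> Dx a0 ab; have -> : b = a + (b - a) by rewrite addrC subrK.
rewrite (esfD F)// ?subr_ge0//; apply: energy_le_start; rewrite ?subr_ge0//.
exact: (esf_dom F).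
Qed.

(** EVI integrated over [[0, h]]; monotonicity of the energy allows its final value to replace the
    values at intermediate times. *)
Lemma evi_increment x v (h M : R) : D x -> D v -> 0 <= h ->
  (forall r, 0 < r -> r < h -> mdist (w x r) v ^+ 2 <= M) ->
  mdist (w x h) v ^+ 2 <=
    mdist x v ^+ 2 + h * (L * M + 2 * (p v - p (w x h))).
Proof.
move=> Dx Dv h0 dM.
rewrite [h * _]mulrC.
have := @dini_affine_le R (fun r => mdist (w x r) v ^+ 2) 0 h
  (L * M + 2 * (p v - p (w x h))) 0.
rewrite (esf0 F)// subr0 mul0r mul0r addr0; apply => //.
  exact: continuous_sqr_mdist_flow.
move=> t t0 th; apply: dini_upper_le (esf_evi F Dx Dv t0).
rewrite mul0r addr0 lerD//; first by rewrite ler_wpM2l// dM.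
by rewrite ler_pM2l// lerB// energy_nonincreasing// ltW.
Qed.

Lemma flow_cvg0 x : D x -> w x r @[r --> (0 : R)] --> x.
Proof. by move=> Dx; rewrite -[X in _ --> X](esf0 F Dx); exact: (esf_continuous F). Qed.

Lemma flow_near_start x (e : R) : D x -> 0 < e ->
  \forall h \near 0^'+, forall r, 0 <= r -> r <= h -> mdist (w x r) x <= e.
Proof.
move=> Dx e0.
have := flow_cvg0 Dx.
move=> /metricType_numDomainType.cvgrPdist_lt/(_ _ e0)/nbhs_ballP[d /= d0 H].
near=> h => r r0 rh; rewrite metric_sym ltW//; apply: H.
rewrite /ball /= sub0r normrN ger0_norm//; apply: (le_lt_trans rh).
by near: h; exact: nbhs_right_lt.
Unshelve. all: by end_near. Qed.

Lemma energy_lsc_start x (e : R) : D x -> 0 < e ->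
  \forall h \near 0^'+, p x - e < p (w x h).
Proof.
move=> Dx e0.
near=> h; have : D (w x h) -> p x - e < p (w x h).
  by near: h; apply: (cvg_at_right_filter (flow_cvg0 Dx)) (esf_lsc F Dx e0).
by apply; apply: (esf_dom F).
Unshelve. all: by end_near. Qed.

(* In the sum of the two EVI increments, from x tested with [w y h] and from y
   tested with x, the energy of [w y h] cancels. *)
Lemma contraction_dini x y (e : R) : D x -> D y -> 0 < e ->
  \forall h \near 0^'+, mdist (w x h) (w y h) ^+ 2 <=
    mdist x y ^+ 2 + h * (2 * L * mdist x y ^+ 2 + e).
Proof.
move: (L0) => L_ge0 Dx Dy e0; set d := mdist x y.
have d0 : 0 <= d by exact: mdist_ge0.
(* Distances move by at most [2 * k] on [[0, h]], and [k] is such that (d + 2k)^2 is at most d^2 +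
   c; the resulting error [2 * L * c] is at most half of [e]. *)
pose c := e / (4 * (L + 1)).
have L1 : 0 < L + 1 by rewrite ltr_wpDl.
have c0 : 0 < c by rewrite divr_gt0// mulr_gt0.
have Lc : 4 * L * c <= e.
  have : c * (4 * (L + 1)) = e by rewrite /c divfK// gt_eqF// mulr_gt0.
  lra.
pose k := Num.min 1 (c / (4 * (d + 1))).
have k0 : 0 < k by rewrite lt_min ltr01 divr_gt0// mulr_gt0//; lra.
have k1 : k <= 1 by rewrite ge_min lexx.
have kd : k * (4 * (d + 1)) <= c.
  by rewrite -ler_pdivlMr ?ge_min ?lexx ?orbT// mulr_gt0//; lra.
near=> h; have h0 : 0 < h by [].
have wx r : 0 <= r -> r <= h -> mdist (w x r) x <= k.
  by move: r; near: h; exact: flow_near_start.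
have wy r : 0 <= r -> r <= h -> mdist (w y r) y <= k.
  by move: r; near: h; exact: flow_near_start.
have dM r r' : 0 <= r -> r <= h -> 0 <= r' -> r' <= h ->
    mdist (w x r) (w y r') ^+ 2 <= d ^+ 2 + c.
  move=> r0 rh r'0 r'h; have := wx r r0 rh; have := wy r' r'0 r'h.
  have := metric_triangle (w x r) x (w y r').
  have := metric_triangle x y (w y r').
  have := mdist_ge0 (w x r) (w y r'); rewrite (metric_sym y) -/d.
  set u := mdist _ _; set a := mdist _ _; set b := mdist _ _.
  move: (mdist x (w y r')) => g *.
  have : u <= d + 2 * k by lra.
  by nra.
have Dyh : D (w y h) by apply: (esf_dom F) => //; exact: ltW.
have H1 : mdist (w x h) (w y h) ^+ 2 <= _ := evi_increment Dx Dyh (ltW h0)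
  (fun r r0 rh => dM r h (ltW r0) (ltW rh) (ltW h0) (lexx h)).
have H2 : mdist (w y h) x ^+ 2 <=
    mdist y x ^+ 2 + h * (L * (d ^+ 2 + c) + 2 * (p x - p (w y h))).
  apply: evi_increment => // r r0 rh.
  rewrite metric_sym -[x in mdist x](esf0 F Dx).
  exact: dM (lexx 0) (ltW h0) (ltW r0) (ltW rh).
(* After the cancellation only [p x - p (w x h)] remains, which lower semicontinuity makes small. *)
have px : p x - e / 8 < p (w x h).
  by near: h; apply: energy_lsc_start => //; lra.
move: H1 H2; rewrite (metric_sym (w y h)) (metric_sym y) -/d.
move: (mdist (w x h) _) (mdist x (w y h)) (p (w y h)) => a b q H1 H2.
have : h * (p x - p (w x h)) <= h * (e / 8) by rewrite ler_pM2l//; lra.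
have : h * (4 * L * c) <= h * e by rewrite ler_pM2l.
have : 0 < h * e by rewrite mulr_gt0.
lra.
Unshelve. all: by end_near. Qed.

(** The semigroup law transports the estimate at time 0 to any time [r], starting from [w x r] and
    [w y r]; Gronwall then applies. *)
Lemma contraction_sqr x y (t : R) : D x -> D y -> 0 <= t ->
  mdist (w x t) (w y t) ^+ 2 <= expR (2 * L * t) * mdist x y ^+ 2.
Proof.
move=> Dx Dy t0.
have := @gronwall R (fun r => mdist (w x r) (w y r) ^+ 2) (2 * L) 0 t.
rewrite !(esf0 F)// mul0r addr0; apply => //.
- by apply: continuous_sqr_mdist; exact: (esf_continuous F).
- by move=> r; exact: sqr_ge0.
- by rewrite mulr_ge0.
move=> r r0 rt e e0; rewrite add0r; near=> h.
have h0 : 0 < h by [].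
rewrite !(esfD F) ?(ltW r0) ?(ltW h0)//; near: h.
by apply: contraction_dini => //; apply: (esf_dom F) => //; exact: ltW.
Unshelve. all: by end_near. Qed.

Lemma contraction x y (t : R) : D x -> D y -> 0 <= t ->
  mdist (w x t) (w y t) <= expR (L * t) * mdist x y.
Proof.
move=> Dx Dy t0.
rewrite -(@ler_pXn2r _ 2)// ?nnegrE ?mdist_ge0 ?mulr_ge0 ?expR_ge0 ?mdist_ge0//.
rewrite exprMn -expRM_natl mulrA; exact: contraction_sqr.
Qed.
End EVI.

(** * Slopes *)

Definition global_slope_le (R : realType) (X : metricType R) (D : set X)
    (p : X -> R) (L : R) x s :=
  forall v, D v -> p x - p v <= s * mdist x v + L / 2 * mdist x v ^+ 2.

Section Slope.
Variables (R : realType) (X : metricType R) (D : set X) (p : X -> R) (L : R).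
Variable w : X -> R -> X.
Hypothesis F : evi_semiflow D p L w.
Implicit Types x y v : X.

Let L0 : 0 <= L := esf_ge0 F.

(** EVI tested with the starting point bounds the derivative of the squared distance [f ^+ 2] by
    2f(s + Lf), so [f] itself grows at rate at most s + Lf. Gronwall is applied to the regularised
    root, and then [k] tends to 0. *)
Lemma flow_speed x (s b : R) : D x -> 0 <= s -> 0 <= b ->
  (forall t, 0 < t -> t < b ->
    p x - p (w x t) <= s * mdist (w x t) x + L / 2 * mdist (w x t) x ^+ 2) ->
  mdist (w x b) x <= expR (L * b) * (s * b).
Proof.
move=> Dx s0 b0 sl.
pose f r := mdist (w x r) x.
have f0 r : 0 <= f r by exact: mdist_ge0.
have cf : continuous f.
  apply: continuous_mdist; first exact: (esf_continuous F).
  by move=> ?; exact: cvg_cst.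
have key (k : R) : 0 < k -> f b <= expR (L * b) * (k + s * b).
  move=> k0; pose g r := Num.sqrt (f r ^+ 2 + k ^+ 2).
  have cg : continuous g.
    move=> r; apply: (@continuous_comp _ _ _ (fun r => f r ^+ 2 + k ^+ 2) Num.sqrt).
      apply: cvgD; last exact: cvg_cst.
      by apply: (@cvgM _ _ _ _ f); exact: cf.
    exact: sqrt_continuous.
  have -> : k = g 0.
    by rewrite /g /f (esf0 F)// mdistxx expr0n add0r sqrtr_sqr gtr0_norm.
  have fg : f b <= g b.
    by rewrite -[f b]ger0_norm// -sqrtr_sqr ler_sqrt ?addr_ge0 ?sqr_ge0// lerDl sqr_ge0.
  apply: (le_trans fg); apply: gronwall => // [t|t t0 tb]; first exact: sqrtr_ge0.
  apply: dini_sqrt => //; apply: dini_upper_le (esf_evi F Dx Dx t0).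
  by have := sl t t0 tb; rewrite -/(f t); lra.
have : expR (L * b) * (k + s * b) @[k --> 0^'+] --> expR (L * b) * (0 + s * b).
  apply: cvgM; first exact: cvg_cst.
  by apply: cvgD; [exact: (cvg_at_right_filter cvg_id)|exact: cvg_cst].
rewrite add0r => H; apply: (ler_cvg_to (cvg_cst (f b)) H).
by near=> k; apply: key.
Unshelve. all: by end_near. Qed.

Lemma flow_speed_global x (s b : R) : D x -> 0 <= s -> 0 <= b ->
  global_slope_le D p L x s -> mdist (w x b) x <= expR (L * b) * (s * b).
Proof.
move=> Dx s0 b0 gs; apply: flow_speed => // t t0 _.
by rewrite metric_sym; apply: gs; apply: (esf_dom F) => //; exact: ltW.
Qed.

(* By contraction the speed at time t is at most e^(2Lt) s, which bounds the
   right derivative in EVI at time t from below. *)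
Lemma local_slope_flow x v (s t : R) : D x -> D v -> 0 <= s -> 0 < t ->
  (forall r, 0 < r -> r < t ->
    p x - p (w x r) <= s * mdist (w x r) x) ->
  p (w x t) - p v <= expR (2 * L * t) * s * mdist (w x t) v
    + L / 2 * mdist (w x t) v ^+ 2.
Proof.
move: L0 => L_ge0 Dx Dv s0 t0 sl; apply/ler_addgt0Pr => e e0.
set y := w x t; set a := mdist y v; set c := expR (2 * L * t) * s.
have c0 : 0 <= c by rewrite mulr_ge0// expR_ge0.
have a0 : 0 <= a by exact: mdist_ge0.
have /near_right0P[d d0 H] := esf_evi F Dx Dv t0 e0.
pose h := Num.min (d / 2) (t / 2).
have h0 : 0 < h by rewrite lt_min !divr_gt0.
have hd : h < d by rewrite gt_min; apply/orP; left; lra.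
have ht : h < t by rewrite gt_min; apply/orP; right; lra.
have {}H := H h h0 hd; rewrite /= -/y -/a in H.
(* Both points are images under the flow at time [t], of [w x h] and of [x], so the speed near the
   start controls their distance. *)
have sp : mdist (w x (t + h)) y <= c * h.
  rewrite addrC (esfD F) ?(ltW h0) ?(ltW t0)//.
  apply: (le_trans (contraction F (esf_dom F Dx (ltW h0)) Dx (ltW t0))).
  have := @flow_speed x s h Dx s0 (ltW h0).
  have : expR (L * t) * expR (L * h) <= expR (2 * L * t).
    rewrite -expRD ler_expR; nra.
  move=> le1 le2.
  apply: (le_trans (ler_wpM2l (expR_ge0 _) (le2 _))).
    move=> r r0 rh; apply: (le_trans (sl r r0 (lt_trans rh ht))).
    by rewrite lerDl mulr_ge0 ?sqr_ge0// divr_ge0.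
  rewrite [leLHS]mulrA /c -[leRHS]mulrA.
  by apply: ler_wpM2r => //; rewrite mulr_ge0// ltW.
have tr := metric_triangle y (w x (t + h)) v.
rewrite (metric_sym y (w x (t + h))) -/a in tr.
have b0 := mdist_ge0 (w x (t + h)) v.
move: (mdist (w x (t + h)) v) (mdist (w x (t + h)) y) sp H tr b0 => b u sp H tr b0.
(* The squared distance to [v] drops at rate at most [2 * a * c]; comparison with the upper bound
   from EVI gives the claim. *)
have ab : a ^+ 2 - 2 * a * (c * h) <= b ^+ 2.
  have : a <= b + c * h by lra.
  have : 0 <= c * h by rewrite mulr_ge0// ltW.
  by move: (c * h) => g g0 abg; have [ag|ga] := leP a g; nra.
rewrite -(@ler_pM2l _ (2 * h)) ?mulr_gt0//; nra.
Qed.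

(** The bound along the flow is used with [s + e] at small times [t]. As [t] tends to 0, lower
    semicontinuity recovers [p x] and continuity the distances; then [e] tends to 0. *)
Lemma local_slope_global x (s : R) : D x -> 0 <= s ->
  (forall e, 0 < e -> \forall v \near x, D v -> p x - p v <= (s + e) * mdist x v) ->
  global_slope_le D p L x s.
Proof.
move=> Dx s0 sl v Dv.
have key (e : R) : 0 < e ->
    p x - p v <= (s + e) * mdist x v + L / 2 * mdist x v ^+ 2 + e.
  move=> e0; have se : 0 <= s + e by lra.
  have /(flow_cvg0 F Dx)/nbhs_ballP[d /= d0 Hd] := sl e e0.
  have cw : continuous (fun t => mdist (w x t) v).
    apply: continuous_mdist; first exact: (esf_continuous F).
    by move=> ?; exact: cvg_cst.
  pose g t := expR (2 * L * t) * (s + e) * mdist (w x t) v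
    + L / 2 * mdist (w x t) v ^+ 2 + e.
  have cg : g t @[t --> 0^'+] --> g 0.
    apply: cvg_at_right_filter; apply: cvgD; last exact: cvg_cst.
    apply: cvgD; apply: cvgM.
    - apply: cvgM; last exact: cvg_cst.
      apply: (@continuous_comp _ _ _ ( *%R (2 * L)) (@expR R)).
        exact: mulrl_continuous.
      exact: continuous_expR.
    - exact: cw.
    - exact: cvg_cst.
    - by apply: (@cvgM _ _ _ _ (fun t => mdist (w x t) v)); exact: cw.
  have -> : (s + e) * mdist x v + L / 2 * mdist x v ^+ 2 + e = g 0.
    by rewrite /g mulr0 expR0 mul1r (esf0 F).
  apply: (ler_cvg_to (cvg_cst (p x - p v)) cg); near=> t.
  have t0 : 0 < t by [].
  have td : t < d by near: t; exact: nbhs_right_lt.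
  have lsc : p x - e < p (w x t) by near: t; exact: (energy_lsc_start F).
  have := @local_slope_flow x v (s + e) t Dx Dv se t0.
  rewrite /g => /(_ _)/le_trans H.
  suff : p (w x t) - p v <= expR (2 * L * t) * (s + e) * mdist (w x t) v
    + L / 2 * mdist (w x t) v ^+ 2 by lra.
  apply: local_slope_flow => // r r0 rt; rewrite metric_sym; apply: Hd.
    by rewrite /ball /= sub0r normrN gtr0_norm//; lra.
  by apply: (esf_dom F) => //; exact: ltW.
have cl : (s + e) * mdist x v + L / 2 * mdist x v ^+ 2 + e @[e --> 0^'+] -->
    (s + 0) * mdist x v + L / 2 * mdist x v ^+ 2 + 0.
  apply: cvgD; last exact: (cvg_at_right_filter cvg_id).
  apply: cvgD; last exact: cvg_cst.
  apply: cvgM; last exact: cvg_cst.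
  by apply: cvgD; [exact: cvg_cst|exact: (cvg_at_right_filter cvg_id)].
rewrite !addr0 in cl; apply: (ler_cvg_to (cvg_cst _) cl).
by near=> e; apply: key.
Unshelve. all: by end_near. Qed.

End Slope.

(** * One discrete step *)

Lemma expR_le_1D2x (R : realType) (x : R) : 0 <= x -> x <= 2^-1 ->
  expR x <= 1 + 2 * x.
Proof.
move=> x0 x1; have := expR_ge1Dx (- x); have := expR_gt0 (- x).
have : expR x * expR (- x) = 1 by rewrite -expRD subrr expR0.
have := expR_gt0 x.
move: (expR x) (expR (- x)) => a b *; nra.
Qed.

(** * Approximate midpoints and geodesic points *)

Section ApproximateLength.
Variables (R : realType) (X : metricType R) (D : set X).
Hypothesis D_length : approximate_length_subset D.

(** For the two distances a and b, the identity (a + b)^2 + (a - b)^2 = 2(a^2 + b^2) and a + b >= l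
    bound both a + b - l and the absolute value of a - b by l e / 2. *)
Lemma approximate_midpoint x0 x1 (d : R) : D x0 -> D x1 -> 0 < d ->
  exists m, [/\ D m, mdist m x0 <= mdist x0 x1 / 2 + d &
    mdist m x1 <= mdist x0 x1 / 2 + d].
Proof.
move=> D0 D1 d0; set l := mdist x0 x1; have l0 : 0 <= l by exact: mdist_ge0.
pose e := Num.min 2^-1 (d / (l + 1)).
have e0 : 0 < e by rewrite lt_min invr_gt0 ltr0n divr_gt0//; lra.
have e1 : e <= 2^-1 by rewrite ge_min lexx.
have el : e * (l + 1) <= d.
  by rewrite -ler_pdivlMr ?ge_min ?lexx ?orbT//; lra.
have [|m Dm] := D_length D0 D1 (e := e); first by apply/andP; split; lra.
rewrite -/l (metric_sym x0 m) => H; exists m.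
have := metric_triangle x0 m x1; rewrite -/l (metric_sym x0 m).
have := mdist_ge0 m x0; have := mdist_ge0 m x1; move: H.
move: (mdist m x0) (mdist m x1) => a b H b0 a0 tr.
have le0 : 0 <= l * e by rewrite mulr_ge0// ltW.
have ab : a + b <= l + l * e / 2.
  rewrite -(@ler_pXn2r _ 2)// ?nnegrE; [|lra|lra].
  have := sqr_ge0 (a - b); have : 0 <= l ^+ 2 * e by rewrite mulr_ge0 ?sqr_ge0// ltW.
  lra.
have dab : (a - b) ^+ 2 <= (l * e / 2) ^+ 2 by nra.
have : a - b <= l * e / 2.
  rewrite (le_trans (ler_norm _))// -[leRHS]ger0_norm; last lra.
  by rewrite -[`|a - b|]sqrtr_sqr -[leRHS]sqrtr_sqr ler_wsqrtr.
have : b - a <= l * e / 2.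
  rewrite (le_trans (ler_norm _))// -[leRHS]ger0_norm; last lra.
  by rewrite distrC -[`|a - b|]sqrtr_sqr -[leRHS]sqrtr_sqr ler_wsqrtr.
by split => //; lra.
Qed.

(** Repeated bisection towards [y]. Dyadic weights suffice, because only points approaching [y] are
    tested later. *)
Lemma approximate_geodesic_point k x y (d : R) : D x -> D y -> 0 < d ->
  exists m, [/\ D m, mdist m y <= 2^-1 ^+ k * mdist x y + d &
    mdist m x <= (1 - 2^-1 ^+ k) * mdist x y + d].
Proof.
move=> Dx Dy; elim: k d => [|k IH] d d0.
  by exists x; split => //; rewrite ?mdistxx expr0; lra.
have d4 : 0 < d / 4 by lra.
have [m [Dm my mx]] := IH _ d4.
have [m' [Dm' m'm m'y]] := approximate_midpoint Dm Dy d4.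
exists m'; split => //; rewrite exprS; first lra.
have := metric_triangle m' m x; lra.
Qed.

End ApproximateLength.

(** * Approximate convexity along the flow *)

Section Convexity.
Variables (R : realType) (X : metricType R) (D : set X) (p : X -> R) (L : R).
Variable w : X -> R -> X.
Hypothesis F : evi_semiflow D p L w.
Implicit Types x y v m : X.

Let L0 : 0 <= L := esf_ge0 F.

(** The energy of [m] is uncontrolled, so EVI from [m] is tested with [x], whose global slope bounds
    the energy difference; 2sd <= s + s d^2 makes the bound affine in d^2. *)
Lemma sqr_mdist_flow_le x m (s h : R) : D x -> D m -> 0 <= s -> 0 <= h ->
  global_slope_le D p L x s ->
  mdist (w m h) x ^+ 2 <= expR ((2 * L + s) * h) * (mdist m x ^+ 2 + s * h).
Proof.
move: L0 => L_ge0 Dx Dm s0 h0 gs.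
have := @gronwall R (fun r => mdist (w m r) x ^+ 2) (2 * L + s) s h.
rewrite (esf0 F)//; apply => //.
- exact: (continuous_sqr_mdist_flow F).
- by move=> t; exact: sqr_ge0.
- lra.
move=> t t0 th; apply: dini_upper_le (esf_evi F Dm Dx t0).
have := gs _ (esf_dom F Dm (ltW t0)); rewrite (metric_sym x).
move: (mdist _ x) => d; have := sqr_ge0 (d - 1).
move=> /(mulr_ge0 s0); lra.
Qed.

(** With a, b the distances from [m], the right side equals th(1 - th)(a + b)^2 + (th a - (1 - th)
    b)^2. *)
Lemma weighted_sqr_mdist x y m (th : R) : 0 <= th -> th <= 1 ->
  th * (1 - th) * mdist x y ^+ 2 <=
    th * mdist m x ^+ 2 + (1 - th) * mdist m y ^+ 2.
Proof.
move=> th0 th1; have := metric_triangle x m y; rewrite (metric_sym x m).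
have := mdist_ge0 x y.
move: (mdist x y) (mdist m x) (mdist m y) => l a b l0 tr.
have l2 : l ^+ 2 <= (a + b) ^+ 2 by nra.
have : 0 <= th * (1 - th) * ((a + b) ^+ 2 - l ^+ 2) by rewrite !mulr_ge0// subr_ge0.
have := sqr_ge0 (th * a - (1 - th) * b); lra.
Qed.

(* EVI from m, tested with x and y with weights th and 1 - th. *)
Lemma flow_convexity x y m (th h Z : R) : D x -> D y -> D m ->
  0 <= th -> th <= 1 -> 0 < h ->
  Z = th * mdist m x ^+ 2 + (1 - th) * mdist m y ^+ 2 ->
  p (w m h) <= th * p x + (1 - th) * p y
    + (Z - th * (1 - th) * mdist x y ^+ 2) / (2 * h) + L / 2 * (expR (L * h) * Z).
Proof.
move=> Dx Dy Dm th0 th1 h0 ZE; have L_ge0 := L0.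
have th1' : 0 <= 1 - th by lra.
pose f r := th * mdist (w m r) x ^+ 2 + (1 - th) * mdist (w m r) y ^+ 2.
have f0 r : 0 <= f r by rewrite addr_ge0// mulr_ge0// sqr_ge0.
have fZ : f 0 = Z by rewrite /f (esf0 F).
have Z0 : 0 <= Z by rewrite -fZ.
have cf : continuous f.
  move=> r; apply: cvgD; apply: cvgM; (try exact: cvg_cst);
    exact: (continuous_sqr_mdist_flow F).
pose c := th * p x + (1 - th) * p y.
have df t : 0 < t -> t < h ->
    dini_upper f t (L * f t + 2 * (c - p (w m h))).
  move=> t0 tlth.
  have := dini_upperD (dini_upperZ th0 (esf_evi F Dm Dx t0))
    (dini_upperZ th1' (esf_evi F Dm Dy t0)).
  apply: dini_upper_le.
  have := energy_nonincreasing F Dm (ltW t0) (ltW tlth).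
  by rewrite /f /c; lra.
have wx := weighted_sqr_mdist x y (w m h) th0 th1; rewrite -/(f h) in wx.
have wZ := weighted_sqr_mdist x y m th0 th1; rewrite -ZE in wZ.
rewrite -/c.
have EZ : 0 <= L / 2 * (expR (L * h) * Z).
  by rewrite !mulr_ge0// expR_ge0.
(* If the energy is at most [c], the other terms are nonnegative. Otherwise the energy term is
   negative, so [f] grows at rate at most [L] and EVI can be integrated. *)
have [cp|cp] := leP (p (w m h)) c.
  have : 0 <= (Z - th * (1 - th) * mdist x y ^+ 2) / (2 * h).
    by rewrite divr_ge0 ?subr_ge0//; lra.
  lra.
have fM t : 0 <= t -> t < h -> f t <= expR (L * h) * Z.
  move=> t0 tlth; have := @gronwall R f L 0 t cf f0 L_ge0 (lexx 0) t0.
  rewrite fZ mul0r addr0 => H; apply: (le_trans (H _)).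
    move=> r r0 rt; apply: dini_upper_le (df r r0 (lt_trans rt tlth)); lra.
  by apply: ler_wpM2r => //; rewrite ler_expR ler_wpM2l// ltW.
have := @dini_affine_le R f 0 h (L * (expR (L * h) * Z) + 2 * (c - p (w m h))) 0
  cf (ltW h0).
rewrite fZ subr0 mul0r mul0r addr0 => H.
have {}H : f h <= Z + (L * (expR (L * h) * Z) + 2 * (c - p (w m h))) * h.
  apply: H => t t0 tlth; apply: dini_upper_le (df t t0 tlth).
  by rewrite mul0r addr0 lerD2r ler_wpM2l// fM// ltW.
rewrite -lerBlDr -lerBlDl ler_pdivlMr ?mulr_gt0//.
by move: (expR _ * Z) wx H => M; lra.
Qed.

End Convexity.

(** * Slope, energy drop and error of a single step *)

Section Step.
Variables (R : realType) (X : metricType R) (D : set X) (p : X -> R) (L : R).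
Variable w : X -> R -> X.
Hypothesis F : evi_semiflow D p L w.
Hypothesis D_length : approximate_length_subset D.
Variables (x y : X) (tau eta s : R).
Hypotheses (Dx : D x) (Dy : D y) (tau0 : 0 < tau) (eta0 : 0 <= eta) (s0 : 0 <= s).
Hypothesis y_min : forall v, D v -> (2 * tau)^-1 * mdist y x ^+ 2 + p y <=
  (2 * tau)^-1 * mdist v x ^+ 2 + p v + eta / 2 * mdist y x * mdist v y.
Hypothesis x_slope : global_slope_le D p L x s.

Let L0 : 0 <= L := esf_ge0 F.
Let a := mdist y x.
Let a0 : 0 <= a := mdist_ge0 y x.

(** Minimality bounds the local slope at [y]: moving by r raises the squared distance to [x] by at
    most 2ar + r^2. The flow turns this into a global bound. *)
Lemma step_slope : global_slope_le D p L y (a * (tau^-1 + eta / 2)).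
Proof.
have ti : 0 < tau^-1 by rewrite invr_gt0.
apply: (local_slope_global F) => // [|e e0].
  by rewrite mulr_ge0// addr_ge0 ?divr_ge0// ltW.
near=> v => Dv; have := y_min Dv; have := metric_triangle v y x.
have := mdist_ge0 v x; have := mdist_ge0 v y.
have : mdist v y <= 2 * tau * e.
  rewrite metric_sym; near: v; apply: metricType_numDomainType.cvgr_dist_le => //.
  by rewrite !mulr_gt0.
rewrite -/a invfM (metric_sym y v).
move: (mdist v y) (mdist v x) => r q re r0 q0 tr.
have q2 : q ^+ 2 <= (a + r) ^+ 2 by move: a0; nra.
move: (ler_wpM2l (ltW ti) q2) (ler_wpM2l (ltW ti) (ler_wpM2l r0 re)).
have -> : tau^-1 * (r * (2 * tau * e)) = 2 * r * e.
  by rewrite (mulrC 2) !mulrA (mulrC tau^-1) -(mulrA r) mulVf ?gt_eqF// mulr1; ring.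
lra.
Unshelve. all: by end_near. Qed.

(** Here th = 2^-k. Minimality is tested with a flow point started near the geodesic point at
    distance th a from [y]; in the limit both sides are compared after division by th, and a
    nonnegative multiple of L th is discarded. *)
Lemma step_drop_pow k :
  a ^+ 2 / tau * (1 - 2^-1 ^+ k / 2) <= p x - p y + (L + eta) / 2 * a ^+ 2.
Proof.
have L_ge0 := L0; have a_ge0 := a0.
have geo := @approximate_geodesic_point _ _ _ D_length k x y.
move: geo; have := exprn_gt0 k (_ : 0 < 2^-1 :> R); have := @exprn_ile1 R k 2^-1.
move: (2^-1 ^+ k) => th th1 th0 geo.
have {}th0 : 0 < th by apply: th0; rewrite invr_gt0.
have {}th1 : th <= 1 by apply: th1; [rewrite invr_ge0|rewrite invf_le1//; lra].
set s' := a * (tau^-1 + eta / 2).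
have s'0 : 0 <= s' by rewrite mulr_ge0// addr_ge0 ?divr_ge0// ?invr_ge0 ltW.
have th1' : 0 <= 1 - th by lra.
pose A (h : R) := (1 - th) * a + h * h.
pose B (h : R) := th * a + h * h.
(* [A h], [B h] and [G h] are the bounds for the flow at time h from a point of
   the domain within h^2 of the geodesic point; h then tends to 0. *)
pose G (h : R) :=
  (2 * tau)^-1 * (expR ((2 * L + s) * h) * (A h * A h + s * h))
  + (th * p x + (1 - th) * p y + (2 * th * (1 - th) * a * h + h * h * h / 2)
    + L / 2 * (expR (L * h) * (th * (A h * A h) + (1 - th) * (B h * B h))))
  + eta / 2 * a * Num.sqrt (expR ((2 * L + s') * h) * (B h * B h + s' * h)).
have cE c : continuous (fun h : R => expR (c * h)).
  move=> h; apply: (@continuous_comp _ _ _ ( *%R c) (@expR R)).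
    exact: mulrl_continuous.
  exact: continuous_expR.
have cA : continuous A.
  by move=> h; apply: cvgD; [exact: cvg_cst|apply: cvgM; exact: cvg_id].
have cB : continuous B.
  by move=> h; apply: cvgD; [exact: cvg_cst|apply: cvgM; exact: cvg_id].
have cG : G h @[h --> 0^'+] --> G 0.
  have cS : continuous
      (fun h => Num.sqrt (expR ((2 * L + s') * h) * (B h * B h + s' * h))).
    move=> h; apply: (@continuous_comp _ _ _
      (fun h => expR ((2 * L + s') * h) * (B h * B h + s' * h)) Num.sqrt).
      apply: cvgM; first exact: cE.
      apply: cvgD; first by apply: cvgM; exact: cB.
      by apply: cvgM; [exact: cvg_cst|exact: cvg_id].
    exact: sqrt_continuous.
  apply: cvg_at_right_filter.
  apply: cvgD; last by apply: cvgM; [exact: cvg_cst|exact: cS].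
  apply: cvgD; [apply: cvgM; first exact: cvg_cst|apply: cvgD].
  - apply: cvgM; first exact: cE.
    apply: cvgD; first by apply: cvgM; exact: cA.
    by apply: cvgM; [exact: cvg_cst|exact: cvg_id].
  - apply: cvgD; first exact: cvg_cst.
    apply: cvgD; first by apply: cvgM; [exact: cvg_cst|exact: cvg_id].
    apply: cvgM; last exact: cvg_cst.
    by apply: cvgM; [apply: cvgM; exact: cvg_id|exact: cvg_id].
  - apply: cvgM; first exact: cvg_cst.
    apply: cvgM; first exact: cE.
    by apply: cvgD; apply: cvgM; (try exact: cvg_cst); apply: cvgM;
      first [exact: cA|exact: cB].
have key h : 0 < h -> (2 * tau)^-1 * a ^+ 2 + p y <= G h.
  (* With tolerance h^2 the defect of the geodesic point is O(h^2), so it still vanishes after the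
     division by 2h in [flow_convexity]. *)
  move=> h0; have [m [Dm my mx]] := geo _ Dx Dy (mulr_gt0 h0 h0).
  rewrite (metric_sym x y) -/a -/(A h) -/(B h) in mx my.
  have Dz : D (w m h) by apply: (esf_dom F) => //; exact: ltW.
  have zx := sqr_mdist_flow_le F Dx Dm s0 (ltW h0) x_slope.
  have zy := sqr_mdist_flow_le F Dy Dm s'0 (ltW h0) step_slope.
  have pz := flow_convexity F Dx Dy Dm (ltW th0) th1 h0 erefl.
  rewrite (metric_sym x y) -/a in pz.
  have mx0 := mdist_ge0 m x; have my0 := mdist_ge0 m y.
  have mxA : mdist m x ^+ 2 <= A h * A h by rewrite -expr2 ler_pXn2r// nnegrE; lra.
  have myB : mdist m y ^+ 2 <= B h * B h by rewrite -expr2 ler_pXn2r// nnegrE; lra.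
  have ZM : th * mdist m x ^+ 2 + (1 - th) * mdist m y ^+ 2 <=
      th * (A h * A h) + (1 - th) * (B h * B h).
    by rewrite lerD// ler_wpM2l// ltW.
  apply: (le_trans (y_min Dz)); rewrite /G; apply: lerD; first apply: lerD.
  - rewrite ler_wpM2l ?invr_ge0 ?mulr_ge0 ?(ltW tau0)//.
    by apply: (le_trans zx); rewrite ler_wpM2l ?expR_ge0// lerD2r.
  - apply: (le_trans pz); apply: lerD; last first.
      by rewrite ler_wpM2l ?divr_ge0// ler_wpM2l// expR_ge0.
    rewrite lerD2l ler_pdivrMr ?mulr_gt0//; move: ZM; rewrite /A /B; lra.
  - rewrite ler_wpM2l ?mulr_ge0 ?divr_ge0//.
    rewrite -[leLHS]ger0_norm ?mdist_ge0// -sqrtr_sqr ler_wsqrtr//.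
    by apply: (le_trans zy); rewrite ler_wpM2l ?expR_ge0// lerD2r.
have : (2 * tau)^-1 * a ^+ 2 + p y <= G 0.
  by apply: (ler_cvg_to (cvg_cst _) cG); near=> h; apply: key.
rewrite /G /A /B !mulr0 !mul0r !addr0 expR0 !mul1r.
have tha : 0 <= th * a by rewrite mulr_ge0// ltW.
rewrite -expr2 -[th * a * (th * a)]expr2 sqrtr_sqr ger0_norm// invfM => H.
rewrite -(@ler_pM2l _ th)//.
have : 0 <= L * (th * th) * a ^+ 2 by rewrite !mulr_ge0 ?sqr_ge0// ltW.
lra.
Unshelve. all: by end_near. Qed.

Lemma step_drop : a ^+ 2 / tau <= p x - p y + (L + eta) / 2 * a ^+ 2.
Proof.
have H : a ^+ 2 / tau * (1 - 2^-1 ^+ k / 2) @[k --> \oo] -->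
    a ^+ 2 / tau * (1 - 0 / 2).
  apply: cvgM; first exact: cvg_cst.
  apply: cvgB; first exact: cvg_cst.
  apply: cvgM; last exact: cvg_cst.
  by apply: cvg_expr; rewrite ger0_norm ?invr_ge0// invf_lt1//; lra.
rewrite mul0r subr0 mulr1 in H.
by apply: (ler_cvg_to H (cvg_cst _)); near=> k; exact: step_drop_pow.
Unshelve. all: by end_near. Qed.

Hypothesis tau_small : (2 * L + 2 * eta) * tau <= 1.

(** The slope at [x] bounds the energy drop in [step_drop] from above; dividing by [a] gives the
    second bound, and smallness of [tau] makes its factor at least 1/2. *)
Lemma step_length : a <= 2 * tau * s /\ a * (1 - (L + eta / 2) * tau) <= tau * s.
Proof.
have small := tau_small.
have L_ge0 := L0; have a_ge0 := a0.
have H : a * (1 - (L + eta / 2) * tau) <= tau * s.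
  have [->|an0] := eqVneq a 0; first by rewrite mul0r mulr_ge0// ltW.
  have ap : 0 < a by rewrite lt_neqAle eq_sym an0.
  rewrite -(@ler_pM2l _ a)//.
  have := x_slope Dy; rewrite (metric_sym x y) -/a => sl.
  have := step_drop; rewrite ler_pdivrMr// => dr.
  have := ler_wpM2r (ltW tau0) sl; lra.
split => //.
have : a * ((L + eta / 2) * tau) <= a * 2^-1.
  have et := mulr_ge0 eta0 (ltW tau0); have Lt := mulr_ge0 L_ge0 (ltW tau0).
  by apply: ler_wpM2l => //; lra.
lra.
Qed.

Lemma step_slope_growth :
  a * (tau^-1 + eta / 2) <= s * (1 + (2 * L + 2 * eta) * tau).
Proof.
have small := tau_small; have [_ H] := step_length; have L_ge0 := L0.
have a_ge0 := a0; have s_ge0 := s0.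
rewrite -(@ler_pM2r _ tau)//.
have -> : a * (tau^-1 + eta / 2) * tau = a * (1 + eta * tau / 2).
  by field; rewrite gt_eqF.
have := mulr_ge0 eta0 (ltW tau0); have := mulr_ge0 L_ge0 (ltW tau0).
have := ltW tau0; move: small H.
have -> : (2 * L + 2 * eta) * tau = 2 * (L * tau) + 2 * (eta * tau) by ring.
have -> : (L + eta / 2) * tau = L * tau + eta * tau / 2 by ring.
move: (L * tau) (eta * tau) => l e small H t0 l0 e0.
have q0 : 0 <= 1 + 2 * l + 2 * e by lra.
apply: le_trans (_ : tau * s * (1 + 2 * l + 2 * e) <= _); last lra.
apply: le_trans (ler_wpM2r q0 H); rewrite -mulrA; apply: ler_wpM2l => //; nra.
Qed.

(** EVI gives a^2 - 2 tau (p x - p y) + s^2 tau^2 up to O(tau^3). By [step_drop] the first two terms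
    are at most -a^2 up to O(tau^3), and [a] is tau times the new slope up to a factor 1 +
    O(tau). *)
Lemma step_error : mdist (w x tau) y ^+ 2 <=
  tau ^+ 2 * (s ^+ 2 - (a * (tau^-1 + eta / 2)) ^+ 2
              + (28 * L + 13 * eta) * tau * s ^+ 2).
Proof.
have small := tau_small; have [a2 _] := step_length; have L_ge0 := L0.
have a_ge0 := a0; have s_ge0 := s0; have t_ge0 := ltW tau0.
have lt0 := mulr_ge0 L_ge0 t_ge0; have et0 := mulr_ge0 eta0 t_ge0.
have ts0 := mulr_ge0 t_ge0 s_ge0.
have dist_x r : 0 < r -> r < tau -> mdist (w x r) x <= s * r * (1 + 2 * (L * tau)).
  move=> r0 rt; apply: (le_trans (flow_speed_global F Dx s0 (ltW r0) x_slope)).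
  have Lr : L * r <= L * tau by rewrite ler_wpM2l// ltW.
  have Lr0 : 0 <= L * r by rewrite mulr_ge0// ltW.
  have : expR (L * r) <= 1 + 2 * (L * r) by apply: expR_le_1D2x => //; lra.
  move=> E; rewrite mulrC; apply: ler_wpM2l; first by rewrite mulr_ge0// ltW.
  lra.
have {}H : mdist (w x tau) y ^+ 2 <= a ^+ 2
    + (- 2 * (p x - p y) + 24 * L * s ^+ 2 * tau ^+ 2) * tau + s ^+ 2 * tau ^+ 2.
  (* The constant 24 is 16 from the distance to [y], 4 from [sd] and 4 from the quadratic part of
     the slope bound. *)
  have := @dini_affine_le R (fun r => mdist (w x r) y ^+ 2) 0 tau
    (- 2 * (p x - p y) + 24 * L * s ^+ 2 * tau ^+ 2) (2 * s ^+ 2)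
    (continuous_sqr_mdist_flow F Dx) t_ge0.
  rewrite (esf0 F)// (metric_sym x y) -/a subr0 expr0n /= subr0.
  have -> : 2 * s ^+ 2 / 2 = s ^+ 2 by lra.
  apply=> r r0 rt; apply: dini_upper_le (esf_evi F Dx Dy r0).
  have Dr : D (w x r) by apply: (esf_dom F) => //; exact: ltW.
  have := x_slope Dr; have := dist_x r r0 rt; rewrite (metric_sym x (w x r)).
  have := metric_triangle (w x r) x y; rewrite (metric_sym x y) -/a.
  have := mdist_ge0 (w x r) y; have := mdist_ge0 (w x r) x.
  move: (mdist (w x r) y) (mdist (w x r) x) (p (w x r)) => u d q d0 u0 tr dr sl.
  have sr0 : 0 <= s * r by rewrite mulr_ge0// ltW.
  have srt : s * r <= s * tau by rewrite ler_wpM2l// ltW.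
  have d2 : d <= 2 * (s * tau) by nra.
  have u4 : u <= 4 * (s * tau) by lra.
  have u16 : u ^+ 2 <= 16 * (s * tau) ^+ 2 by nra.
  have d4 : d ^+ 2 <= 4 * (s * tau) ^+ 2 by nra.
  have sd : s * d <= s ^+ 2 * r + 2 * L * (s * tau) ^+ 2.
    apply: (le_trans (ler_wpM2l s_ge0 dr)).
    have : 0 <= 2 * s * (L * tau) * (s * tau - s * r).
      by rewrite !mulr_ge0// subr_ge0.
    lra.
  have Lu := ler_wpM2l L_ge0 u16; have Ld := ler_wpM2l L_ge0 d4.
  lra.
apply: (le_trans H).
have dr := step_drop.
have {dr} : a ^+ 2 <= tau * (p x - p y) + (L + eta) / 2 * a ^+ 2 * tau.
  by move: dr; rewrite ler_pdivrMr//; lra.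
set s' := a * _.
have s'a : s' * tau = a * (1 + eta * tau / 2).
  by rewrite /s'; field; rewrite gt_eqF.
have a_s' : (s' * tau) ^+ 2 <= a ^+ 2 + 9 * (eta * tau) * (tau * s) ^+ 2.
  rewrite s'a; have : a ^+ 2 <= 4 * (tau * s) ^+ 2 by nra.
  move=> a4; have := ler_wpM2l et0 a4.
  have : eta * tau <= 2^-1 by lra.
  have := sqr_ge0 a; have := sqr_ge0 (tau * s).
  move: (eta * tau) et0 => e e0 *; nra.
(* The correction in [step_drop] contributes 4(L + eta), whence 28 = 24 + 4 and 13 = 9 + 4. *)
have : a ^+ 2 <= 4 * (tau * s) ^+ 2 by nra.
move=> /(ler_wpM2l (mulr_ge0 (addr_ge0 L_ge0 eta0) t_ge0)).
lra.
Qed.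

End Step.

(** * Convergence of the iterates *)

Definition mm_step (R : realType) (X : metricType R) (D : set X) (p : X -> R)
    (tau eta : R) (x y : X) : Prop :=
  forall v, D v -> (2 * tau)^-1 * mdist y x ^+ 2 + p y <=
    (2 * tau)^-1 * mdist v x ^+ 2 + p v + eta / 2 * mdist y x * mdist v y.

Section Convergence.
Variables (R : realType) (X : metricType R) (D : set X) (p : X -> R) (L : R).
Variable w : X -> R -> X.
Hypothesis F : evi_semiflow D p L w.
Hypothesis D_length : approximate_length_subset D.
Variables (eta s0 : R) (u0 : X).
Hypotheses (eta0 : 0 <= eta) (s0_ge0 : 0 <= s0) (Du0 : D u0).
Hypothesis u0_slope : global_slope_le D p L u0 s0.

Let L0 : 0 <= L := esf_ge0 F.
Let K := 2 * L + 2 * eta.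
Let K' := 28 * L + 13 * eta.

Section Iterates.
Variables (tau : R) (U : nat -> X).
Hypotheses (tau0 : 0 < tau) (tau_small : K * tau <= 1).
Hypotheses (U0 : U 0%N = u0) (DU : forall n, D (U n)).
Hypothesis U_step : forall n, mm_step D p tau eta (U n) (U n.+1).

Let slope n := if n is m.+1 then mdist (U n) (U m) * (tau^-1 + eta / 2) else s0.

Let slope_ge0 n : 0 <= slope n.
Proof.
case: n => [//|n]; rewrite mulr_ge0 ?mdist_ge0// addr_ge0 ?divr_ge0//.
by rewrite invr_ge0 ltW.
Qed.

Let slopeP n : global_slope_le D p L (U n) (slope n).
Proof.
case: n => [|n]; first by rewrite U0.
exact: (step_slope F (DU n.+1) tau0 eta0 (@U_step n)).
Qed.

Let slope_le n : slope n <= s0 * expR (K * (n%:R * tau)).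
Proof.
elim: n => [|n IH]; first by rewrite mul0r mulr0 expR0 mulr1.
have := step_slope_growth F D_length (DU n) (DU n.+1) tau0 eta0 (slope_ge0 n)
  (@U_step n) (@slopeP n) tau_small.
move=> /le_trans; apply; rewrite -/K.
apply: (le_trans (ler_wpM2l (slope_ge0 n) (expR_ge1Dx _))).
apply: (le_trans (ler_wpM2r (expR_ge0 _) IH)).
rewrite -mulrA -expRD; apply: ler_wpM2l => //; rewrite ler_expR.
rewrite -[in leRHS]natr1; lra.
Qed.

(** Contraction carries the earlier error forward and one new step error is added; the squared
    slopes telescope. [T] serves to bound all slopes uniformly, and [rho] is free. *)
Lemma iterate_error (T rho : R) n : 0 < rho -> n%:R * tau <= T ->
  mdist (U n) (w u0 (n%:R * tau)) <= expR (L * (n%:R * tau)) / 2 *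
    (n%:R * tau * rho + tau / rho *
      (s0 ^+ 2 - slope n ^+ 2 + K' * (n%:R * tau) * (s0 * expR (K * T)) ^+ 2)).
Proof.
move=> rho0; set sg := s0 * expR (K * T).
have L_ge0 := L0; have eta_ge0 := eta0; have tau_gt0 := tau0.
have K0 : 0 <= K by rewrite addr_ge0// mulr_ge0.
elim: n => [|n IH] nT.
  by rewrite U0 mul0r (esf0 F)// mdistxx !(mul0r, mulr0, subrr, addr0).
have n1 : n.+1%:R * tau = n%:R * tau + tau by rewrite -natr1; ring.
have nt0 : 0 <= n%:R * tau by rewrite mulr_ge0// ltW.
have nT' : n%:R * tau <= T by rewrite n1 in nT; lra.
have {IH} := IH nT'; set E := mdist (U n) _; set B := (X in _ * X) => IH.
have Dn : D (w u0 (n%:R * tau)) by exact: (esf_dom F).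
set d := mdist (w (U n) tau) (U n.+1).
have dE : d ^+ 2 <= tau ^+ 2 * (slope n ^+ 2 - slope n.+1 ^+ 2 + K' * tau * sg ^+ 2).
  have := step_error F D_length (DU n) (DU n.+1) tau0 eta0 (slope_ge0 n)
    (@U_step n) (@slopeP n) tau_small.
  move=> /le_trans; apply; rewrite -/(slope n.+1) -/K' ler_wpM2l ?sqr_ge0// lerD2l.
  apply: ler_wpM2l; first by rewrite mulr_ge0 ?(ltW tau0)// addr_ge0// mulr_ge0.
  rewrite ler_pXn2r// ?nnegrE// ?mulr_ge0 ?expR_ge0//.
  apply: (le_trans (slope_le n)); apply: ler_wpM2l => //.
  by rewrite ler_expR ler_wpM2l.
have d0 : 0 <= d by exact: mdist_ge0.
set b := tau * rho + tau / rho * (slope n ^+ 2 - slope n.+1 ^+ 2 + K' * tau * sg ^+ 2).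
(* AM-GM with the free parameter [tau * rho] replaces the Cauchy-Schwarz
   inequality for the sum of the one-step errors. *)
have db : 2 * d <= b.
  have tr : 0 < tau * rho by rewrite mulr_gt0.
  have : 2 * (tau * rho) * d <= (tau * rho) ^+ 2 + d ^+ 2.
    by have := sqr_ge0 (tau * rho - d); lra.
  have -> : b = ((tau * rho) ^+ 2 + tau ^+ 2 *
      (slope n ^+ 2 - slope n.+1 ^+ 2 + K' * tau * sg ^+ 2)) / (tau * rho).
    by rewrite /b; field; rewrite !gt_eqF.
  by rewrite ler_pdivlMr//; lra.
have tri : mdist (U n.+1) (w u0 (n.+1%:R * tau)) <= d + expR (L * tau) * E.
  rewrite n1 (esfD F) ?(ltW tau0)//.
  apply: (le_trans (metric_triangle _ (w (U n) tau) _)).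
  rewrite metric_sym lerD2l; apply: (contraction F) => //; exact: ltW.
apply: (le_trans tri).
have -> : n.+1%:R * tau * rho + tau / rho *
   (s0 ^+ 2 - slope n.+1 ^+ 2 + K' * (n.+1%:R * tau) * sg ^+ 2) = B + b.
  by rewrite /B /b n1; ring.
have -> : expR (L * (n.+1%:R * tau)) = expR (L * (n%:R * tau)) * expR (L * tau).
  by rewrite n1 mulrDr expRD.
have e1 : 1 <= expR (L * (n%:R * tau)) * expR (L * tau).
  rewrite -expRD -[leLHS]expR0 ler_expR.
  by have := mulr_ge0 L_ge0 nt0; have := mulr_ge0 L_ge0 (ltW tau0); lra.
have b0 : 0 <= b by lra.
have := ler_wpM2r b0 e1; have := ler_wpM2l (expR_ge0 (L * tau)) IH.
by move: db; clearbody b B E d; lra.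
Qed.

End Iterates.

Lemma iterate_converge (T e : R) : 0 <= T -> 0 < e ->
  \forall tau \near 0^'+, forall (U : nat -> X) n, U 0%N = u0 ->
    (forall k, D (U k)) -> (forall k, mm_step D p tau eta (U k) (U k.+1)) ->
    n%:R * tau <= T -> mdist (U n) (w u0 (n%:R * tau)) <= e.
Proof.
move=> T0 e0; have L_ge0 := L0; have eta_ge0 := eta0.
have K0 : 0 <= K by rewrite addr_ge0// mulr_ge0.
have K'0 : 0 <= K' by rewrite addr_ge0// mulr_ge0.
pose M := expR (L * T); have M0 : 0 < M by exact: expR_gt0.
(* First [rho] makes the term without [tau] at most [e], then [tau] makes the other one at most [e];
   the factor 1/2 in [iterate_error] absorbs the sum. *)
pose rho := e / (M * (T + 1)).
have T1 : 0 < T + 1 by lra.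
have rho0 : 0 < rho by rewrite divr_gt0// mulr_gt0.
have MT : M * (T * rho) <= e.
  have -> : e = M * (T + 1) * rho by rewrite /rho; field; rewrite !gt_eqF.
  have : 0 < M * rho by rewrite mulr_gt0.
  lra.
pose Q := s0 ^+ 2 + K' * T * (s0 * expR (K * T)) ^+ 2.
have Q0 : 0 <= Q by rewrite addr_ge0 ?sqr_ge0// mulr_ge0 ?sqr_ge0// mulr_ge0.
have Q1 : 0 < Q + 1 by rewrite ltr_wpDl.
near=> tau => U n U0 DU U_step nT.
have tau0 : 0 < tau by [].
have nt0 : 0 <= n%:R * tau by rewrite mulr_ge0// ltW.
have tK : K * tau <= 1.
  have : tau <= (K + 1)^-1.
    by near: tau; apply: nbhs_right_le; rewrite invr_gt0; lra.
  rewrite -[_^-1]mul1r ler_pdivlMr; lra.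
have tQ : M * (tau / rho * Q) <= e.
  have : tau <= e * rho / (M * (Q + 1)).
    by near: tau; apply: nbhs_right_le; apply: divr_gt0; exact: mulr_gt0.
  rewrite ler_pdivlMr ?mulr_gt0// => H.
  have -> : M * (tau / rho * Q) = M * tau * Q / rho by ring.
  rewrite ler_pdivrMr//.
  have : 0 < M * tau by rewrite mulr_gt0.
  lra.
have := iterate_error tau0 tK U0 DU U_step rho0 nT.
move=> /le_trans; apply; set B := (X in _ / 2 * X).
have ML : expR (L * (n%:R * tau)) <= M by rewrite ler_expR ler_wpM2l.
have BB : B <= T * rho + tau / rho * Q.
  apply: lerD; first by apply: ler_wpM2r => //; exact: ltW.
  apply: ler_wpM2l; first by rewrite divr_ge0// ltW.
  rewrite /Q lerD//; first by rewrite gerBl sqr_ge0.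
  by apply: ler_wpM2r; [exact: sqr_ge0|exact: ler_wpM2l].
have E0 := expR_ge0 (L * (n%:R * tau)).
have P0 : 0 <= T * rho + tau / rho * Q.
  by apply: addr_ge0; apply: mulr_ge0 => //; [|apply: divr_ge0]; exact: ltW.
have := ler_wpM2l E0 BB; have := ler_wpM2r P0 ML.
by clearbody B; lra.
Unshelve. all: by end_near. Qed.

Lemma interpolant_converge (t e : R) : 0 <= t -> 0 < e ->
  \forall tau \near 0^'+, forall U : nat -> X, U 0%N = u0 ->
    (forall k, D (U k)) -> (forall k, mm_step D p tau eta (U k) (U k.+1)) ->
    mdist (w u0 t) (interpolant tau U t) <= e.
Proof.
move=> t0 e0; have e2 : 0 < e / 2 by lra.
have cw : w u0 r @[r --> t] --> w u0 t by exact: (esf_continuous F).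
move: cw => /metricType_numDomainType.cvgrPdist_le/(_ _ e2)/nbhs_ballP[d /= d0 Hd].
near=> tau => U U0 DU U_step; rewrite /interpolant.
have tau0 : 0 < tau by [].
have tau1 : tau < 1 by near: tau; exact: nbhs_right_lt.
have taud : tau < d by near: tau; exact: nbhs_right_lt.
set n := `|Num.ceil (t / tau)|%N.
(* The absolute value in [interpolant] thus changes nothing, and n tau lies in [t, t + tau). *)
have c0 : 0 <= Num.ceil (t / tau) by rewrite ceil_ge0 (lt_le_trans (ltrN10 _))// divr_ge0// ltW.
have nE : n%:R = (Num.ceil (t / tau))%:~R :> R by rewrite -[in RHS](gez0_abs c0).
have n1 : t <= n%:R * tau by rewrite -ler_pdivrMr// nE ceil_ge.
have n2 : n%:R * tau < t + tau.
  have := ceilB1_lt (t / tau).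
  rewrite intrB -nE ltrBlDr -(ltr_pM2r tau0) mulrDl divfK ?gt_eqF//; lra.
have H1 : mdist (w u0 t) (w u0 (n%:R * tau)) <= e / 2.
  by apply: Hd; rewrite /ball /= ltr_norml; lra.
have H2 : mdist (U n) (w u0 (n%:R * tau)) <= e / 2.
  have nT : n%:R * tau <= t + 1 by lra.
  clear nE n1 n2 H1; move: (n) nT => m; move: U m U0 DU U_step; near: tau.
  by apply: iterate_converge => //; lra.
have := metric_triangle (w u0 t) (w u0 (n%:R * tau)) (U n).
rewrite (metric_sym (w u0 (n%:R * tau))); lra.
Unshelve. all: by end_near. Qed.
End Convergence.

(** * Existence of discrete steps *)

Section Ekeland.
Variables (R : realType) (X : metricType R) (D : set X) (f : X -> R) (b : R).
Hypothesis f_ge : forall v, D v -> b <= f v.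
Hypothesis f_lsc : forall x e, D x -> 0 < e ->
  \forall y \near x, D y -> f x - e < f y.
Hypothesis f_complete : forall c, complete_set [set x | D x /\ f x <= c].

(** The points below [x] in Ekeland's order. *)
Let T (e : R) x := [set v | D v /\ f v + e * mdist v x <= f x].

Let T_trans e x y z : 0 < e -> T e x y -> T e y z -> T e x z.
Proof.
move=> e0 [Dy yx] [Dz zy]; split => //.
by have := ler_wpM2l (ltW e0) (metric_triangle z y x); lra.
Qed.

(** Each iterate is chosen below the previous one and halves the gap to the infimum there, so the
    sets [T e (u n)] shrink to their common point [y]. A violating [v] would lie in all of them,
    hence equal [y]. *)
Lemma ekeland (e : R) v0 : D v0 -> 0 < e -> exists2 y,
  D y /\ f y + e * mdist y v0 <= f v0 &
  forall v, D v -> f y <= f v + e * mdist v y.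
Proof.
move=> D0 e0.
have Tid x : D x -> T e x x by move=> Dx; split; rewrite ?mdistxx ?mulr0 ?addr0.
pose i x := inf (f @` T e x).
have has_i x : D x -> has_inf (f @` T e x).
  move=> Dx; split; first by exists (f x); exists x => //; exact: Tid.
  by exists b => _ [v [Dv _] <-]; exact: f_ge.
have i_le x v : D x -> T e x v -> i x <= f v.
  by move=> Dx Tv; apply: ge_inf; [case: (has_i x Dx)|exists v].
have next x : exists y, D x -> T e x y /\ f y - i x <= (f x - i x) / 2.
  have [Dx|nDx] := pselect (D x); last by exists x.
  have := i_le x x Dx (Tid x Dx); rewrite le_eqVlt => /predU1P[ix|ix].
    by exists x => _; split; [exact: Tid|rewrite ix; lra].
  have h0 : 0 < (f x - i x) / 2 by lra.
  have [_ [y Ty <-]] := inf_adherent h0 (has_i x Dx).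
  by rewrite -/(i x) => fy; exists y => _; split => //; lra.
have {next}[g gP] := choice next.
pose u n := iter n g v0.
have Du n : D (u n).
  by elim: n => [//|n IH]; have [[]] := gP _ IH.
have uS n : T e (u n) (u n.+1) by have [] := gP _ (Du n).
have uT n k : T e (u n) (u (n + k)%N).
  elim: k => [|k IH]; first by rewrite addn0; exact: Tid.
  by rewrite addnS; apply: T_trans IH (uS _).
have i_mono n : i (u n) <= i (u n.+1).
  apply: lb_le_inf; first by case: (has_i _ (Du n.+1)).
  by move=> _ [v Tv <-]; apply: i_le => //; exact: T_trans (uS n) Tv.
pose c := f v0 - i v0.
have gap n : f (u n) - i (u n) <= c * 2^-1 ^+ n.
  elim: n => [|n IH]; first by rewrite expr0 mulr1.
  have [_] := gP _ (Du n); rewrite -[g (u n)]/(u n.+1) exprSr.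
  by have := i_mono n; lra.
have small n v : T e (u n) v -> e * mdist v (u n) <= c * 2^-1 ^+ n.
  move=> Tv; have := i_le _ _ (Du n) Tv; have [_] := Tv; have := gap n; lra.
have c0 : c * 2^-1 ^+ n @[n --> \oo] --> (0 : R).
  apply: cvg_geometric; rewrite ger0_norm; last by rewrite invr_ge0.
  by rewrite invf_lt1//; lra.
have small_near (d : R) : 0 < d -> \forall n \near \oo, forall v, T e (u n) v ->
    mdist v (u n) <= d.
  move=> d0; have ed : 0 < e * d by rewrite mulr_gt0.
  near=> n => v Tv.
  have cn : c * 2^-1 ^+ n < e * d by near: n; exact: (cvgr_lt _ c0 _ ed).
  by rewrite -(@ler_pM2l _ e)// (le_trans (small n v Tv))// ltW.
have cu : cauchy (u @ \oo).
  apply/cauchyP => d d0; have d2 : 0 < d / 2 by lra.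
  have [N _ HN] := small_near _ d2.
  exists (u N), N => //= k Nk; rewrite -metricType_numDomainType.ball_mdistE /=.
  have : T e (u N) (u k) by rewrite -(subnKC Nk).
  by move/(HN N (leqnn N)); rewrite metric_sym; lra.
have [n|y [Dy _] uy] := f_complete (c := f v0) _ cu.
  split=> //; have [_] := uT 0%N n; rewrite add0n /=.
  by have := mulr_ge0 (ltW e0) (mdist_ge0 (u n) v0); lra.
have Ty n : T e (u n) y.
  split=> //; apply/ler_addgt0Pr => d d0.
  have d2 : 0 < d / 2 by lra.
  have de : 0 < d / (2 * e) by rewrite divr_gt0// mulr_gt0.
  have /uy lsc := f_lsc Dy d2.
  have near_y := metricType_numDomainType.cvgr_dist_le uy de.
  near \oo => k.
  have nk : (n <= k)%N by near: k; exact: nbhs_infty_ge.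
  have lk : D (u k) -> f y - d / 2 < f (u k) by near: k; exact: lsc.
  have : mdist y (u k) <= d / (2 * e) by near: k; exact: near_y.
  rewrite ler_pdivlMr ?mulr_gt0// => yk.
  have [_ uk] : T e (u n) (u k) by rewrite -(subnKC nk).
  have := ler_wpM2l (ltW e0) (metric_triangle y (u k) (u n)).
  by have := lk (Du k); lra.
exists y; first exact: (Ty 0%N).
move=> v Dv; rewrite leNgt; apply/negP => vy.
have Tv : T e y v by split => //; lra.
have vyE : v = y.
  apply: mdist_positivity; apply/eqP; rewrite eq_le mdist_ge0 andbT.
  apply/ler_addgt0Pr => d d0; rewrite add0r; have d2 : 0 < d / 2 by lra.
  near \oo => n.
  have uv : forall v', T e (u n) v' -> mdist v' (u n) <= d / 2.
    by near: n; exact: small_near.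
  have := uv v (T_trans e0 (Ty n) Tv); have := uv y (Ty n).
  by have := metric_triangle v (u n) y; rewrite (metric_sym (u n)); lra.
by move: vy; rewrite vyE mdistxx; lra.
Unshelve. all: by end_near. Qed.

End Ekeland.

Section Existence.
Variables (R : realType) (X : metricType R) (D : set X) (p : X -> R) (L : R).
Variable w : X -> R -> X.
Hypothesis F : evi_semiflow D p L w.
Hypothesis p_complete : forall c, complete_set [set x | D x /\ p x <= c].

Let L0 : 0 <= L := esf_ge0 F.

(** If [x] does not minimise [f], lower semicontinuity keeps the points with energy at most [f v1]
    at distance at least [d] from [x]. Ekeland's error with constant [d / 2] is then at most the one
    permitted for eta = 1. *)
Lemma mm_step_exists (tau s : R) x : D x -> 0 <= s -> 0 < tau ->
  2 * L * tau <= 1 -> global_slope_le D p L x s ->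
  exists y, [/\ D y, mm_step D p tau 1 x y &
    (2 * tau)^-1 * mdist y x ^+ 2 + p y <= p x].
Proof.
move=> Dx s0 tau0 small sl.
pose f v := (2 * tau)^-1 * mdist v x ^+ 2 + p v.
have ti : 0 < (2 * tau)^-1 by rewrite invr_gt0 mulr_gt0.
have [xmin|[v1 D1 v1x]] :
    (forall v, D v -> p x <= f v) \/ exists2 v, D v & f v < p x.
    have [|/forall2NP H] := pselect (exists2 v, D v & f v < p x); first by right.
    by left=> v Dv; have [//|/negP] := H v; rewrite -leNgt.
  exists x; split => //; last by rewrite mdistxx expr0n mulr0 add0r.
  move=> v Dv; rewrite mdistxx expr0n mulr0 add0r mulr0 mul0r addr0.
  exact: xmin.
have f_ge v : D v -> p x - s ^+ 2 * tau <= f v.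
  move=> Dv; have := sl v Dv; rewrite /f (metric_sym v); set d := mdist x v => sld.
  (* Half of the quadratic penalty absorbs the [L] term of the slope bound, the other half the
     linear term [s * d]. *)
  have L4 : L / 2 <= (2 * tau)^-1 / 2.
    by rewrite ler_pM2r// -[_^-1]mul1r ler_pdivlMr ?mulr_gt0//; lra.
  have := ler_wpM2r (sqr_ge0 d) L4.
  suff : s * d <= s ^+ 2 * tau + (2 * tau)^-1 / 2 * d ^+ 2 by lra.
  have := sqr_ge0 (2 * tau * s - d).
  move=> /(mulr_ge0 (ltW ti)).
  have -> : (2 * tau)^-1 * (2 * tau * s - d) ^+ 2 =
    2 * (s ^+ 2 * tau + (2 * tau)^-1 / 2 * d ^+ 2 - s * d).
    by field; rewrite gt_eqF.
  lra.
have f_lsc z e : D z -> 0 < e -> \forall y \near z, D y -> f z - e < f y.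
  move=> Dz e0; have e2 : 0 < e / 2 by lra.
  have c2 : (fun y => (2 * tau)^-1 * mdist y x ^+ 2) y @[y --> z] -->
      (2 * tau)^-1 * mdist z x ^+ 2.
    apply: cvgM; first exact: cvg_cst.
    by apply: (@continuous_sqr_mdist _ _ _ id (cst x)) => t; [exact: cvg_id|exact: cvg_cst].
  near=> y => Dy.
  have : D y -> p z - e / 2 < p y by near: y; exact: (esf_lsc F).
  have : (2 * tau)^-1 * mdist z x ^+ 2 - e / 2 < (2 * tau)^-1 * mdist y x ^+ 2.
    by near: y; apply: (cvgr_gt _ c2); lra.
  by rewrite /f => H /(_ Dy); lra.
have f_complete c : complete_set [set x | D x /\ f x <= c].
  move=> u uc cu.
  have [n|z [Dz _] uz] := p_complete (c := c) _ cu.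
    have [Dn fn] := uc n; split => //; apply: le_trans fn.
    by rewrite /f lerDr mulr_ge0 ?sqr_ge0// ltW.
  exists z => //; split => //; apply/ler_addgt0Pr => e e0.
  have /uz lsc := f_lsc z e Dz e0.
  near \oo => n; have [Dn fn] := uc n.
  have : D (u n) -> f z - e < f (u n) by near: n; exact: lsc.
  by move=> /(_ Dn); lra.
have /(esf_lsc F Dx)/nbhs_ballP[d /= d0 Hd] : 0 < p x - f v1 by lra.
have d2 : 0 < d / 2 by lra.
have [y [Dy yv1] ymin] := ekeland f_ge f_lsc f_complete D1 d2.
have fy : f y <= f v1 by have := mulr_ge0 (ltW d2) (mdist_ge0 y v1); lra.
have dy : d <= mdist y x.
  rewrite leNgt; apply/negP => yx.
  have /Hd : ball x d y.
    by rewrite -metricType_numDomainType.ball_mdistE /= metric_sym.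
  move=> /(_ Dy).
  have : 0 <= (2 * tau)^-1 * mdist y x ^+ 2 by rewrite mulr_ge0 ?sqr_ge0// ltW.
  by move: fy; rewrite {1}/f; lra.
exists y; split => //; last by rewrite -/(f y); lra.
move=> v Dv; apply: (le_trans (ymin v Dv)); rewrite lerD2l mul1r.
by apply: ler_wpM2r; [exact: mdist_ge0|lra].
Unshelve. all: by end_near. Qed.

Lemma discrete_exists (tau s : R) u0 : D u0 -> 0 <= s -> 0 < tau ->
  2 * L * tau <= 1 -> global_slope_le D p L u0 s ->
  exists U : nat -> X, [/\ U 0%N = u0, forall n, D (U n),
    forall n, mm_step D p tau 1 (U n) (U n.+1) &
    forall n, (2 * tau)^-1 * mdist (U n.+1) (U n) ^+ 2 + p (U n.+1) <= p (U n)].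
Proof.
move=> D0 s0 tau0 small sl0.
(* Some finite global slope is the invariant: it yields the next step, and [step_slope] restores
   it. *)
pose good x := D x /\ exists2 r, 0 <= r & global_slope_le D p L x r.
have /choice[g gP] : forall x, exists y, good x ->
    [/\ good y, mm_step D p tau 1 x y &
      (2 * tau)^-1 * mdist y x ^+ 2 + p y <= p x].
  move=> x; have [[Dx [r r0 slx]]|ngx] := pselect (good x); last by exists x.
  have [y [Dy yx py]] := mm_step_exists Dx r0 tau0 small slx.
  exists y => _; split => //; split => //.
  exists (mdist y x * (tau^-1 + 1 / 2)).
    by rewrite mulr_ge0 ?mdist_ge0// addr_ge0// ?divr_ge0// invr_ge0 ltW.
  exact: (step_slope F Dy tau0 ler01 yx).
pose U n := iter n g u0.
have goodU n : good (U n).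
  by elim: n => [|n IH]; [split => //; exists s|have [] := gP _ IH].
exists U; split => // n; first by have [] := goodU n.
  by have [] := gP _ (goodU n).
by have [] := gP _ (goodU n).
Qed.
End Existence.

(** * The extended-real formulation *)

Lemma limf_esup_lt (T : choiceType) (X : filteredType T) (R : realType)
    (f : X -> \bar R) (G : set_system X) (c : \bar R) :
  Filter G -> (limf_esup f G < c)%E -> \forall x \near G, (f x < c)%E.
Proof.
move=> FG /ereal_inf_lt[_ [V GV <-] Vc].
apply: filterS GV => x Vx; apply: le_lt_trans Vc.
by apply: ereal_sup_ubound; exists x.
Qed.

Section Link.
Variables (R : realType) (X : metricType R) (phi : X -> \bar R).
Hypothesis phi_gtNy : forall x, (-oo < phi x)%E.
Hypothesis phi_lsc : lower_semicontinuous phi.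

Let D := dom phi.
Let p x := fine (phi x).

Lemma fine_dom x : D x -> phi x = (p x)%:E.
Proof. by move=> Dx; rewrite fineK// fin_real// phi_gtNy Dx. Qed.

Lemma fine_lsc x (e : R) : D x -> 0 < e ->
  \forall y \near x, D y -> p x - e < p y.
Proof.
move=> Dx e0; have [|V xV HV] := phi_lsc (x := x) (a := p x - e).
  by rewrite fine_dom// lte_fin; lra.
apply: filterS xV => y /HV + Dy; by rewrite fine_dom.
Qed.

Lemma complete_sublevels_fine (c : R) : complete_sublevels phi ->
  complete_set [set x | D x /\ p x <= c].
Proof.
move=> cphi u uc cu; have [n|x /= xc ux] := cphi c u _ cu.
  by have [Dn pn] := uc n; rewrite /= fine_dom// lee_fin.
have Dx : D x by apply: le_lt_trans xc _; rewrite ltry.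
by exists x => //; split => //; rewrite -lee_fin -fine_dom.
Qed.

Lemma local_slope_of_metric_slope x : dom (metric_slope phi) x ->
  D x /\ exists2 s : R, 0 <= s & forall e, 0 < e ->
    \forall v \near x, D v -> p x - p v <= (s + e) * mdist x v.
Proof.
rewrite /dom /= /metric_slope; case: ifPn => [Dx|]; last by rewrite ltxx.
case: asboolP => [[_ [V xV VE]] _|_ lim]; split => //.
  exists 0 => // e e0; apply: filterS xV => v Vv Dv.
  have -> : v = x by have : [set x] v by rewrite -VE.
  by rewrite subrr mdistxx mulr0.
(* Any nonnegative real strictly above the limsup serves; -oo is a formal case. *)
have [r r0 limr] : exists2 r : R, 0 <= r &
    (limf_esup (fun y => maxe (phi x - phi y) 0 * ((mdist x y)^-1)%:E) x^' < r%:E)%E.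
  move: lim; case: (limf_esup _ _) => [r _|//|_]; last by exists 0; rewrite ?ltNyr.
  by exists (`|r| + 1); rewrite ?addr_ge0// lte_fin; have := ler_norm r; lra.
exists r => // e e0; have := limf_esup_lt _ limr => /(_ _).
rewrite /dnbhs /within /= => H.
near=> v => Dv; have [->|vx] := eqVneq v x; first by rewrite subrr mdistxx mulr0.
have : (maxe (phi x - phi v) 0 * ((mdist x v)^-1)%:E < r%:E)%E.
  by move: vx; near: v; exact: H.
have d0 : 0 < mdist x v by rewrite mdist_gt0 eq_sym.
rewrite (fine_dom Dv) (fine_dom Dx) -EFinB -EFin_max -EFinM lte_fin ltr_pdivrMr// => lt.
apply: (@le_trans _ _ (r * mdist x v)); last by rewrite ler_pM2r//; lra.
by apply: le_trans (ltW lt); rewrite le_max lexx.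
Unshelve. all: by end_near. Qed.

Lemma discrete_MMP (tau eta : R) u0 (U : nat -> X) :
  discrete_MM phi tau eta u0 U <->
  [/\ U 0%N = u0, forall n, D (U n),
    forall n, mm_step D p tau eta (U n) (U n.+1) &
    forall n, (2 * tau)^-1 * mdist (U n.+1) (U n) ^+ 2 + p (U n.+1) <= p (U n)].
Proof.
split=> -[U0 DU st en]; split => // n.
- by move=> v Dv; have := st n v Dv; rewrite (fine_dom Dv) !(fine_dom (DU _)) -!EFinD lee_fin.
- by have := en n; rewrite !(fine_dom (DU _)) -!EFinD lee_fin.
- by move=> v Dv; rewrite (fine_dom Dv) !(fine_dom (DU _)) -!EFinD lee_fin; exact: st.
- by rewrite !(fine_dom (DU _)) -!EFinD lee_fin; exact: en.
Qed.

Variables (lambda : R) (S : R -> X -> X).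
Hypothesis lambda_le0 : lambda <= 0.
Hypothesis S_flow : EVI_flow lambda phi (closure D) S.

(** Constant extension to negative times, which makes orbits continuous on the whole line. *)
Let w x t := S (Num.max t 0) x.

Lemma flow_semiflow : evi_semiflow D p (- lambda) w.
Proof.
have [_ _ _ flow] := S_flow.
have cD x : D x -> closure D x by move=> Dx; exact: subset_closure.
split.
- by rewrite oppr_ge0.
- exact: fine_lsc.
- move=> x t Dx; have [_ _ S0 [Sd _ _]] := flow x (cD x Dx).
  rewrite le_eqVlt /w => /predU1P[<-|t0]; first by rewrite maxxx S0.
  by rewrite max_l ?ltW//; exact: Sd.
- move=> x Dx t; have [_ S0c S0 [_ Sc _]] := flow x (cD x Dx).
  apply/metricType_numDomainType.cvgrPdist_lt => e e0.
  have [t0|t0|->] := ltgtP t 0.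
  + near=> r; have r0 : r < 0 by near: r; exact: lt_nbhsl.
    by rewrite /w !max_r ?ltW// mdistxx.
  + near=> r; have r0 : 0 < r by near: r; exact: lt_nbhsr.
    rewrite /w !max_l ?ltW//; near: r.
    apply: metricType_numDomainType.cvgr_dist_lt => //; apply: Sc.
    by rewrite in_itv /= t0.
  + move/metricType_numDomainType.cvgrPdist_lt : S0c => /(_ _ e0).
    move=> /near_right0P[d d0 Hd]; rewrite /w maxxx.
    near=> r; have rd : r < d by near: r; exact: lt_nbhsl.
    have [r0|r0] := leP r 0; first by rewrite mdistxx.
    exact: Hd.
- move=> x Dx; have [_ _ S0 _] := flow x (cD x Dx).
  by rewrite /w maxxx S0.
- move=> x s t Dx s0 t0; have [SD _ _ _] := flow x (cD x Dx).
  by rewrite /w !max_l ?addr_ge0// SD.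
- move=> x v t Dx Dv t0; have [_ _ _ [Sd _ Se]] := flow x (cD x Dx).
  have := Se t v t0 Dv; rewrite !fine_dom//; last exact: Sd.
  set z := upper_right_derivative _ _ => H e e0.
  have {}H : (z < (- lambda * mdist (S t x) v ^+ 2 + 2 * (p v - p (S t x)) + e)%:E)%E.
    (* EVI excludes the value +oo, and for -oo the bound is trivial. *)
    case: z H => [r| |] //.
    - by rewrite -EFinM -EFinD -EFinB lee_fin lte_fin; lra.
    - by rewrite mulry gtr0_sg ?invr_gt0// mul1e.
    - by rewrite ltNyr.
  have {}H := limf_esup_lt _ H.
  rewrite /w max_l ?(ltW t0)//; near=> h.
  have h0 : 0 < h by [].
  rewrite max_l ?addr_ge0 ?(ltW h0) ?(ltW t0)//.
  have : (((mdist (S (t + h) x) v ^+ 2 - mdist (S t x) v ^+ 2) / h)%:E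
    < (- lambda * mdist (S t x) v ^+ 2 + 2 * (p v - p (S t x)) + e)%:E)%E.
    by near: h; exact: H.
  by rewrite lte_fin ltr_pdivrMr//; lra.
Unshelve. all: by end_near. Qed.

End Link.

Unset Implicit Arguments.

Theorem corollary5p7 (R : realType) (X : metricType R) (phi : X -> \bar R)
  (phi_gtNy : forall x, (-oo < phi x)%E)
  (phi_proper : dom phi !=set0)
  (phi_lsc : lower_semicontinuous phi)
  (phi_complete : complete_sublevels phi)
  (dom_length : approximate_length_subset (dom phi))
  (lambda : R) (lambda_le0 : lambda <= 0)
  (S : R -> X -> X) (S_flow : EVI_flow lambda phi (closure (dom phi)) S)
  (u0 : X) (u0_slope : dom (metric_slope phi) u0) :
  GMM phi u0 = MM phi u0 /\
  MM phi u0 = [set fun t : {nonneg R} => S t%:num u0].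
Proof.
set p := fun x => fine (phi x).
have F := flow_semiflow phi_gtNy phi_lsc lambda_le0 S_flow.
have [Du0 [s s0 sl]] := local_slope_of_metric_slope phi_gtNy u0_slope.
have gs := local_slope_global F Du0 s0 sl.
have S0 : S 0 u0 = u0.
  by have := esf0 F Du0; rewrite maxxx.
(* Uniformity over all [U] makes this serve every choice of discrete movements, for [MM] and [GMM]
   alike. *)
have conv (eta t e : R) : 0 <= eta -> 0 <= t -> 0 < e -> \forall tau \near 0^'+,
    forall U, discrete_MM phi tau eta u0 U ->
    mdist (S t u0) (interpolant tau U t) <= e.
  move=> eta0 t0 e0.
  have := interpolant_converge F dom_length eta0 s0 Du0 gs t0 e0.
  rewrite max_l// => H; near=> tau => U /(discrete_MMP phi_gtNy)[U0 DU st _].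
  by move: U U0 DU st; near: tau.
have exist : \forall tau \near 0^'+, exists U, discrete_MM phi tau 1 u0 U.
  near=> tau; have tau0 : 0 < tau by [].
  have small : 2 * (- lambda) * tau <= 1.
    have : tau <= (2 * - lambda + 1)^-1.
      by near: tau; apply: nbhs_right_le; rewrite invr_gt0; lra.
    rewrite -[_^-1]mul1r ler_pdivlMr; lra.
  have [U UP] := discrete_exists F (fun c => complete_sublevels_fine phi_gtNy
    (c := c) phi_complete) Du0 s0 tau0 small gs.
  by exists U; apply/(discrete_MMP phi_gtNy).
have unique (u v : X) : (forall e : R, 0 < e -> mdist u v <= e) -> u = v.
  move=> uv; apply: mdist_positivity; apply/eqP; rewrite eq_le mdist_ge0 andbT.
  by apply/ler_addgt0Pr => e e0; rewrite add0r; exact: uv.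
have -> : MM phi u0 = [set fun t : {nonneg R} => S t%:num u0].
  apply/seteqP; split=> [u [_ [eta [eta0 [U [HU cU]]]]]|_ ->].
    apply/funext => t; apply: unique => e e0.
    have e2 : 0 < e / 2 by lra.
    have := cU t => /metricType_numDomainType.cvgrPdist_le/(_ _ e2) H.
    near (0 : R)^'+ => tau.
    have : mdist (u t) (interpolant tau (U tau) t%:num) <= e / 2.
      by near: tau; exact: H.
    have : mdist (S t%:num u0) (interpolant tau (U tau) t%:num) <= e / 2.
      have : discrete_MM phi tau eta u0 (U tau) by near: tau; exact: HU.
      by move: (U tau); near: tau; exact: conv.
    have := metric_triangle (u t) (interpolant tau (U tau) t%:num) (S t%:num u0).
    rewrite [mdist (interpolant _ _ _) _]metric_sym; lra.
  split=> //; exists 1; split => //.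
  (* The constant sequence is a default for those [tau] that admit no discrete movement. *)
  have /choice[U HU] : forall tau : R, exists U : nat -> X,
      (exists U', discrete_MM phi tau 1 u0 U') -> discrete_MM phi tau 1 u0 U.
    move=> tau; have [[U HU]|no] := pselect (exists U, discrete_MM phi tau 1 u0 U).
      by exists U.
    by exists (cst u0).
  exists U; split.
    by near=> tau; apply: HU; near: tau.
  move=> t; apply/metricType_numDomainType.cvgrPdist_le => e e0; near=> tau.
  have : discrete_MM phi tau 1 u0 (U tau) by apply: HU; near: tau.
  by move: (U tau); near: tau; exact: conv.
have cvg_right (tau : nat -> R) : (forall k, 0 < tau k) ->
    tau k @[k --> \oo] --> (0 : R) -> tau k @[k --> \oo] --> 0^'+.
  move=> tau0 ctau P /near_right0P[d d0 Pd]; rewrite /nbhs /=.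
  by near=> k; apply: Pd => //; near: k; exact: (cvgr_lt _ ctau).
split=> //; apply/seteqP; split=> [u [_ [eta [eta0 [tau [U [tau0 ctau HU cU]]]]]]|_ ->].
  apply/funext => t; apply: unique => e e0.
  have e2 : 0 < e / 2 by lra.
  have := cU t => /metricType_numDomainType.cvgrPdist_le/(_ _ e2) H.
  have G := cvg_right _ tau0 ctau _ (conv eta t%:num (e / 2) eta0 (ge0 t) e2).
  near \oo => k.
  have : mdist (u t) (interpolant (tau k) (U k) t%:num) <= e / 2.
    by near: k; exact: H.
  have : mdist (S t%:num u0) (interpolant (tau k) (U k) t%:num) <= e / 2.
    by move: (U k) (HU k); near: k; exact: G.
  have := metric_triangle (u t) (interpolant (tau k) (U k) t%:num) (S t%:num u0).
  rewrite [mdist (interpolant _ _ _) _]metric_sym; lra.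
split=> //; exists 1; split => //.
move: exist => /near_right0P[d d0 Hd].
(* All terms stay below [d], so a discrete movement exists for every [k], as [GMM] demands. *)
pose tau k : R := d / 2 * harmonic k.
have tau0 k : 0 < tau k by rewrite mulr_gt0 ?divr_gt0// harmonic_gt0.
have taud k : tau k < d.
  have : tau k <= d / 2.
    by rewrite /tau ler_piMr ?divr_ge0 ?(ltW d0)// invf_le1 ?ltr0n// ler1n.
  lra.
have /choice[U HU] : forall k, exists U, discrete_MM phi (tau k) 1 u0 U.
  by move=> k; exact: Hd.
have ctau : tau k @[k --> \oo] --> (0 : R).
  rewrite -(mulr0 (d / 2)); apply: cvgM; first exact: cvg_cst.
  exact: cvg_harmonic.
exists tau, U; split => //.
move=> t; apply/metricType_numDomainType.cvgrPdist_le => e e0.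
have G := cvg_right _ tau0 ctau _ (conv 1 t%:num e ler01 (ge0 t) e0).
near=> k.
by move: (U k) (HU k); near: k; exact: G.
Unshelve. all: by end_near. Qed.
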